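(* Let $\lambda\in P^+$ be non-zero and let $\boldsymbol{\xi}=(\xi^\alpha)_{\alpha\in R^+}$ be a $\lambda$-compatible $|R^+|$-tuple of partitions. Assume that for every $\alpha\in R^+$ the partition $\xi^\alpha$ is either rectangular or a special fat hook. Let $s_\alpha=0$ if $\xi^\alpha$ is the empty partition, and otherwise let $s_\alpha$ be the number of non-zero parts of $\xi^\alpha$. Then $V(\boldsymbol{\xi})$ is isomorphic to the quotient of $W_{\rm loc}(\lambda)$ by the submodule generated by the elements $$\{(x^-_\alpha\otimes t^{s_\alpha})w_\lambda:\ \alpha\in R^+\}\ \cup\ \{(x^-_\alpha\otimes t^{s_\alpha-1})^{\xi^\alpha_{s_\alpha}+1}w_\lambda:\ \alpha\in R^+,\ \xi^\alpha \text{ a special fat hook}\}.$$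
   Context: $\mathbf Z_+$ is the set of non-negative integers, $\mathbf N$ the positive integers. $\mathfrak g$ is a simple finite-dimensional complex Lie algebra with Cartan subalgebra $\mathfrak h$, root system $R$, simple roots $\alpha_i$ ($i\in I=\{1,\dots,n\}$), positive roots $R^+$, dominant integral weights $P^+$. For $\alpha\in R^+$, $h_\alpha$ is the coroot and $x^\pm_\alpha\in\mathfrak g_{\pm\alpha}$ are non-zero root vectors with $[h_\alpha,x_\alpha^\pm]=\pm2x_\alpha^\pm$, $[x^+_\alpha,x^-_\alpha]=h_\alpha$; $x_i^\pm=x^\pm_{\alpha_i}$, $h_i=h_{\alpha_i}$. The current algebra is $\mathfrak g[t]=\mathfrak g\otimes\mathbf C[t]$ with $[a\otimes f,b\otimes g]=[a,b]\otimes fg$. For $\lambda\in P^+$ the local Weyl module $W_{\rm loc}(\lambda)$ is the $\mathfrak g[t]$-module generated by $w_\lambda$ with defining relations $(x_i^+\otimes\mathbf C[t])w_\lambda=0$, $(h_i\otimes t^s)w_\lambda=\lambda(h_i)\delta_{s,0}w_\lambda$, $(x_i^-\otimes1)^{\lambda(h_i)+1}w_\lambda=0$ for $i\in I$, $s\in\mathbf Z_+$. A $\lambda$-compatible tuple ($\lambda\neq0$) is a family $\boldsymbol\xi=(\xi^\alpha)_{\alpha\in R^+}$ of partitions $\xi^\alpha=(\xi^\alpha_1\ge\xi^\alpha_2\ge\cdots\ge0)$ with $\sum_{j\ge1}\xi^\alpha_j=\lambda(h_\alpha)$. $V(\boldsymbol\xi)$ is the quotient of $W_{\rm loc}(\lambda)$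 by the submodule generated by all elements $(x_\alpha^+\otimes t)^s(x_\alpha^-\otimes1)^{s+r}w_\lambda$ with $\alpha\in R^+$, $s,r\in\mathbf N$ such that $s+r\ge1+rk+\sum_{j\ge k+1}\xi^\alpha_j$ for some $k\in\mathbf N$. A partition is rectangular if it is empty or of the form $(k^m)$ ($m$ parts all equal to $k$), $k,m\in\mathbf N$. It is a fat hook if it is of the form $(k_1^{s_1},k_2^{s_2})$ with $k_1>k_2$ and $k_j,s_j\in\mathbf N$ (that is, $s_1$ parts equal to $k_1$ followed by $s_2$ parts equal to $k_2$); it is a special fat hook if in addition $s_2=1$. *)

(* Defs.v *)
From HB Require Import structures.
From mathcomp Require Import all_boot all_order all_algebra.
From mathcomp Require Import finmap.
From mathcomp Require Import boolp reals complex.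
From mathcomp.multinomials Require Import monalg.

Set Implicit Arguments.
Unset Strict Implicit.
Unset Printing Implicit Defensive.

Import GRing.Theory.
Local Open Scope fset_scope.
Local Open Scope ring_scope.
Local Open Scope quotient_scope.

HB.mixin Record Lmodule_isLie (K : fieldType) (L : Type)
    of GRing.Lmodule K L := {
  lie : L -> L -> L;
  lieDl : forall z x y, lie (x + y) z = lie x z + lie y z;
  lieZl : forall c x y, lie (c *: x) y = c *: lie x y;
  lieDr : forall z x y, lie z (x + y) = lie z x + lie z y;
  lieZr : forall c x y, lie x (c *: y) = c *: lie x y;
  liexx : forall x, lie x x = 0;
  lie_jacobi : forall x y z,
    lie x (lie y z) + lie y (lie z x) + lie z (lie x y) = 0
}.

#[short(type="lieAlgType")]
HB.structure Definition LieAlgebra (K : fieldType) :=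
  {L of GRing.Lmodule K L & Lmodule_isLie K L}.

#[short(type="finLieAlgType")]
HB.structure Definition FinLieAlgebra (K : fieldType) :=
  {L of Vector K L & LieAlgebra K L}.

Notation "[ 'lie' x , y ]" := (lie x y)
  (at level 0, format "[ 'lie'  x ,  y ]") : ring_scope.

Section LieTheory.
Variables (K : fieldType) (L : lieAlgType K).
Implicit Types x y z : L.

Lemma lie0l x : [lie 0, x] = 0.
Proof. by have := lieZl 0 0 x; rewrite !scale0r. Qed.

Lemma lie0r x : [lie x, 0] = 0.
Proof. by have := lieZr 0 x 0; rewrite !scale0r. Qed.

Lemma lieC x y : [lie x, y] = - [lie y, x].
Proof.
apply/eqP; rewrite -addr_eq0; apply/eqP.
by have := liexx (x + y); rewrite lieDl !lieDr !liexx add0r addr0.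
Qed.

End LieTheory.

(* An element \sum_i x_i (x) t^i is the finitely supported family of its
   coefficients x_i in L. *)
Definition current (K : fieldType) (L : lieAlgType K) : Type := {malg L[nat]}.

Section CurrentAlgebra.
Variables (K : fieldType) (L : lieAlgType K).
Implicit Types (x y : L) (g h k : current L).

HB.instance Definition _ := GRing.Zmodule.copy (current L) {malg L[nat]}.

Definition current_scale (c : K) g : current L :=
  [malg i in msupp g => c *: g@_i].

Lemma current_scaleE c g i : (current_scale c g)@_i = c *: g@_i.
Proof.
by rewrite mcoeffE; case: msuppP => //; rewrite scaler0.
Qed.

Fact current_scaleA a b g :
  current_scale a (current_scale b g) = current_scale (a * b) g.
Proof. by apply/malgP=> i; rewrite !current_scaleE scalerA. Qed.

Fact current_scale1 : left_id 1 current_scale.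
Proof. by move=> g; apply/malgP=> i; rewrite !current_scaleE scale1r. Qed.

Fact current_scaleDr : right_distributive current_scale +%R.
Proof.
by move=> c g h; apply/malgP=> i; rewrite mcoeffD !current_scaleE mcoeffD scalerDr.
Qed.

Fact current_scaleDl g : {morph current_scale^~ g : a b / a + b}.
Proof.
by move=> a b; apply/malgP=> i; rewrite mcoeffD !current_scaleE scalerDl.
Qed.

HB.instance Definition _ := GRing.Zmodule_isLmodule.Build K (current L)
  current_scaleA current_scale1 current_scaleDr current_scaleDl.

Definition current_lie g h : current L :=
  \sum_(i <- msupp g) \sum_(j <- msupp h) << [lie g@_i, h@_j] *g (i + j)%N >>.

Lemma current_lieEw (d e : {fset nat}) g h :
  msupp g `<=` d -> msupp h `<=` e ->
  current_lie g h =
    \sum_(i <- d) \sum_(j <- e) << [lie g@_i, h@_j] *g (i + j)%N >>.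
Proof.
move=> gd he; rewrite /current_lie (big_fset_incl _ gd) /=.
  apply/eq_bigr=> i _; apply/big_fset_incl => // j _ /mcoeff_outdom ->.
  by rewrite lie0r monalgU0.
move=> i _ /mcoeff_outdom gi.
by rewrite big1 // => j _; rewrite gi lie0l monalgU0.
Qed.

Fact current_lieDl k g h :
  current_lie (g + h) k = current_lie g k + current_lie h k.
Proof.
rewrite (current_lieEw (msuppD_le g h) (fsubset_refl _)).
rewrite (current_lieEw (fsubsetUl _ (msupp h)) (fsubset_refl _)).
rewrite (current_lieEw (fsubsetUr (msupp g) _) (fsubset_refl _)).
rewrite -big_split /=; apply/eq_bigr=> i _.
rewrite -big_split /=; apply/eq_bigr=> j _.
by rewrite mcoeffD lieDl monalgUD.
Qed.

Fact current_lieDr k g h :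
  current_lie k (g + h) = current_lie k g + current_lie k h.
Proof.
rewrite (current_lieEw (fsubset_refl _) (msuppD_le g h)).
rewrite (current_lieEw (fsubset_refl _) (fsubsetUl _ (msupp h))).
rewrite (current_lieEw (fsubset_refl _) (fsubsetUr (msupp g) _)).
rewrite -big_split /=; apply/eq_bigr=> i _.
rewrite -big_split /=; apply/eq_bigr=> j _.
by rewrite mcoeffD lieDr monalgUD.
Qed.

Lemma current_lieUU x y i j :
  current_lie << x *g i >> << y *g j >> = << [lie x, y] *g (i + j)%N >>.
Proof.
by rewrite (current_lieEw msuppU_le msuppU_le) !big_seq_fset1 !mcoeffUU.
Qed.

Lemma current_scaleU c x i :
  c *: (<< x *g i >> : current L) = << c *: x *g i >>.
Proof.
apply/malgP=> j; rewrite [LHS]current_scaleE !mcoeffU.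
by case: eqP => _; rewrite ?mulr0n ?scaler0.
Qed.

Lemma current_ind (P : current L -> Prop) :
  P 0 -> (forall g h, P g -> P h -> P (g + h)) ->
  (forall x i, P << x *g i >>) -> forall g, P g.
Proof.
move=> P0 PD PU g; rewrite [g]monalgE.
by apply: big_ind => // i _; apply: PU.
Qed.

Let lie0g h : current_lie 0 h = 0.
Proof. by rewrite /current_lie msupp0 big_seq_fset0. Qed.

Let lieg0 g : current_lie g 0 = 0.
Proof.
by rewrite /current_lie big1 // => i _; rewrite msupp0 big_seq_fset0.
Qed.

Fact current_lieZl c g h : current_lie (c *: g) h = c *: current_lie g h.
Proof.
elim/current_ind: g => [|g1 g2 IH1 IH2|x i].
- by rewrite scaler0 lie0g scaler0.
- by rewrite scalerDr !current_lieDl IH1 IH2 scalerDr.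
elim/current_ind: h => [|h1 h2 IH1 IH2|y j].
- by rewrite !lieg0 scaler0.
- by rewrite !current_lieDr IH1 IH2 scalerDr.
by rewrite current_scaleU !current_lieUU current_scaleU lieZl.
Qed.

Fact current_lieZr c g h : current_lie g (c *: h) = c *: current_lie g h.
Proof.
elim/current_ind: g => [|g1 g2 IH1 IH2|x i].
- by rewrite !lie0g scaler0.
- by rewrite !current_lieDl IH1 IH2 scalerDr.
elim/current_ind: h => [|h1 h2 IH1 IH2|y j].
- by rewrite scaler0 lieg0 scaler0.
- by rewrite scalerDr !current_lieDr IH1 IH2 scalerDr.
by rewrite current_scaleU !current_lieUU current_scaleU lieZr.
Qed.

Let current_lieC g h : current_lie g h + current_lie h g = 0.
Proof.
elim/current_ind: g => [|g1 g2 IH1 IH2|x i].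
- by rewrite lie0g lieg0 addr0.
- by rewrite current_lieDl current_lieDr addrACA IH1 IH2 addr0.
elim/current_ind: h => [|h1 h2 IH1 IH2|y j].
- by rewrite lie0g lieg0 addr0.
- by rewrite current_lieDl current_lieDr addrACA IH1 IH2 addr0.
by rewrite !current_lieUU [(j + i)%N]addnC -monalgUD lieC addNr monalgU0.
Qed.

Fact current_liexx g : current_lie g g = 0.
Proof.
elim/current_ind: g => [|g h gg hh|x i]; first exact: lie0g.
  by rewrite current_lieDl !current_lieDr gg hh add0r addr0 current_lieC.
by rewrite current_lieUU liexx monalgU0.
Qed.

Fact current_lie_jacobi g h k :
  current_lie g (current_lie h k) + current_lie h (current_lie k g)
    + current_lie k (current_lie g h) = 0.
Proof.
have addr3 (a b c a' b' c' : current L) :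
    a + b + c = 0 -> a' + b' + c' = 0 ->
    a + a' + (b + b') + (c + c') = 0.
  by move=> e e'; rewrite (addrACA a) (addrACA (a + b)) e e' addr0.
elim/current_ind: g => [|g1 g2 IH1 IH2|x i].
- by rewrite !(lie0g, lieg0) !addr0.
- by rewrite !(current_lieDl, current_lieDr); apply: addr3.
elim/current_ind: h => [|h1 h2 IH1 IH2|y j].
- by rewrite !(lie0g, lieg0) !addr0.
- by rewrite !(current_lieDl, current_lieDr); apply: addr3.
elim/current_ind: k => [|k1 k2 IH1 IH2|z l].
- by rewrite !(lie0g, lieg0) !addr0.
- by rewrite !(current_lieDl, current_lieDr); apply: addr3.
rewrite !current_lieUU.
have -> : (j + (l + i))%N = (i + (j + l))%N by rewrite addnA addnC.
have -> : (l + (i + j))%N = (i + (j + l))%N by rewrite addnC addnA.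
by rewrite -!monalgUD lie_jacobi monalgU0.
Qed.

HB.instance Definition _ := Lmodule_isLie.Build K (current L)
  current_lieDl current_lieZl current_lieDr current_lieZr
  current_liexx current_lie_jacobi.

Definition current_tensor x (p : {poly K}) : current L :=
  \sum_(i < size p) << p`_i *: x *g (i : nat) >>.

Lemma current_tensorE x p i : (current_tensor x p)@_i = p`_i *: x.
Proof.
rewrite raddf_sum /=; under eq_bigr do rewrite mcoeffU mulrb.
rewrite -big_mkcond /=; have [ltip | leip] := ltnP i (size p).
  by rewrite (big_pred1 (Ordinal ltip)).
rewrite nth_default // scale0r big_pred0 // => j.
by apply/eqP=> ji; have := ltn_ord j; rewrite ji ltnNge leip.
Qed.

Lemma current_tensor_is_linear x : linear (current_tensor x).
Proof.
move=> c p q; apply/malgP=> i.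
rewrite mcoeffD [mcoeff i (c *: current_tensor x p)]current_scaleE.
by rewrite !current_tensorE coefD coefZ scalerDl scalerA.
Qed.

HB.instance Definition _ x :=
  GRing.isLinear.Build K {poly K} (current L) _ (current_tensor x)
    (current_tensor_is_linear x).

Lemma current_tensorDl x y p :
  current_tensor (x + y) p = current_tensor x p + current_tensor y p.
Proof.
by apply/malgP=> i; rewrite mcoeffD !current_tensorE scalerDr.
Qed.

Lemma current_tensorZl c x p :
  current_tensor (c *: x) p = c *: current_tensor x p.
Proof.
apply/malgP=> i; rewrite [RHS]current_scaleE !current_tensorE.
by rewrite !scalerA mulrC.
Qed.

Lemma current_tensorXn x i : current_tensor x 'X^i = << x *g i >>.
Proof.
apply/malgP=> j; rewrite current_tensorE coefXn mcoeffU eq_sym.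
by case: eqP; rewrite ?scale1r ?scale0r.
Qed.

Lemma lie_current_tensor x y p q :
  [lie current_tensor x p, current_tensor y q] =
  current_tensor [lie x, y] (p * q).
Proof.
have monoP (P : {poly K} -> Prop) : P 0 ->
    (forall p1 p2, P p1 -> P p2 -> P (p1 + p2)) ->
    (forall c i, P (c *: 'X^i)) -> forall p1, P p1.
  move=> P0 PD PX p1; rewrite -[p1]coefK poly_def.
  by apply: big_ind => // i _; apply: PX.
elim/monoP: p => [|p1 p2 IH1 IH2|c i].
- by rewrite mul0r !linear0 lie0l.
- by rewrite mulrDl !linearD lieDl IH1 IH2.
elim/monoP: q => [|q1 q2 IH1 IH2|d j].
- by rewrite mulr0 !linear0 lie0r.
- by rewrite mulrDr !linearD lieDr IH1 IH2.
rewrite -scalerAl -scalerAr -exprD !linearZ /= lieZl lieZr !current_tensorXn.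
by rewrite -current_lieUU.
Qed.

End CurrentAlgebra.

Notation "x \otimes p" := (current_tensor x p)
  (at level 38, left associativity) : ring_scope.

Section SubmoduleQuotient.
Variables (R : pzRingType) (V : lmodType R) (S : V -> Prop).

Definition gen_submod : {pred V} := fun v =>
  `[< forall N : {pred V}, submod_closed N ->
        (forall u, S u -> u \in N) -> v \in N >].

Lemma gen_submod_sub u : S u -> u \in gen_submod.
Proof. by move=> Su; apply/asboolP=> N _; apply. Qed.

Lemma gen_submod_min (N : {pred V}) : submod_closed N ->
  (forall u, S u -> u \in N) -> {subset gen_submod <= N}.
Proof. by move=> clN SN v /asboolP; apply. Qed.

Fact gen_submod_closed : submod_closed gen_submod.
Proof.
split=> [|a u v /asboolP uG /asboolP vG]; apply/asboolP=> N clN SN.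
  by have [] := clN.
by have [_] := clN; apply; [apply: uG | apply: vG].
Qed.

HB.instance Definition _ :=
  GRing.isSubmodClosed.Build R V gen_submod gen_submod_closed.

Definition quot_submod : Type := Quotient.quot gen_submod.

HB.instance Definition _ := GRing.Zmodule.on quot_submod.
HB.instance Definition _ := Quotient.on quot_submod.

Definition quot_proj (v : V) : quot_submod := \pi_(Quotient.quot gen_submod) v.

Lemma quot_projP u v : quot_proj u = quot_proj v <-> u - v \in gen_submod.
Proof.
by rewrite (Quotient.idealrBE gen_submod); split=> [/eqP|/eqP].
Qed.

Lemma quot_proj_repr (q : quot_submod) : quot_proj (repr q) = q.
Proof. exact: reprK. Qed.

Lemma quot_projD : {morph quot_proj : u v / u + v}.
Proof. by move=> u v; rewrite /quot_proj !piE. Qed.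

Definition quot_scale (a : R) (q : quot_submod) : quot_submod :=
  quot_proj (a *: repr q).

Lemma quot_projZ a v : quot_proj (a *: v) = quot_scale a (quot_proj v).
Proof.
apply/quot_projP; rewrite -scalerBr; apply: rpredZ.
by apply/quot_projP; rewrite quot_proj_repr.
Qed.

Fact quot_scaleA a b q :
  quot_scale a (quot_scale b q) = quot_scale (a * b) q.
Proof. by rewrite -[q]quot_proj_repr -!quot_projZ scalerA. Qed.

Fact quot_scale1 : left_id 1 quot_scale.
Proof. by move=> q; rewrite -[q]quot_proj_repr -quot_projZ scale1r. Qed.

Fact quot_scaleDr : right_distributive quot_scale +%R.
Proof.
move=> a p q; rewrite -[p]quot_proj_repr -[q]quot_proj_repr.
by rewrite -quot_projD -!quot_projZ -quot_projD scalerDr.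
Qed.

Fact quot_scaleDl q : {morph quot_scale^~ q : a b / a + b}.
Proof.
move=> a b; rewrite -[q]quot_proj_repr.
by rewrite -!quot_projZ -quot_projD scalerDl.
Qed.

HB.instance Definition _ := GRing.Zmodule_isLmodule.Build R quot_submod
  quot_scaleA quot_scale1 quot_scaleDr quot_scaleDl.

Fact quot_proj_is_linear : linear quot_proj.
Proof. by move=> a u v; rewrite quot_projD quot_projZ. Qed.

HB.instance Definition _ :=
  GRing.isLinear.Build R V quot_submod _ quot_proj quot_proj_is_linear.

End SubmoduleQuotient.

Definition isomorphic (R : pzRingType) (V W : lmodType R) : Prop :=
  exists f : {linear V -> W}, bijective f.

Section EnvelopingAlgebra.
Variables (K : fieldType) (L : lieAlgType K).
Implicit Types x y : L.

Local Notation F := {malg K[{fmonom L}]}.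

Definition free_letter x : F := << fmu x >>.

Inductive env_rel : F -> Prop :=
| EnvD x y : env_rel (free_letter (x + y) - (free_letter x + free_letter y))
| EnvZ c x : env_rel (free_letter (c *: x) - c *: free_letter x)
| EnvLie x y : env_rel (free_letter [lie x, y]
    - (free_letter x * free_letter y - free_letter y * free_letter x)).

Definition two_sided_ideal (J : {pred F}) :=
  zmod_closed J /\ forall a u, u \in J -> a * u \in J /\ u * a \in J.

Definition env_ideal : {pred F} := fun f =>
  `[< forall J : {pred F}, two_sided_ideal J ->
        (forall u, env_rel u -> u \in J) -> f \in J >].

Lemma env_ideal_ideal : two_sided_ideal env_ideal.
Proof.
split; first split=> [|u v /asboolP uI /asboolP vI].
- by apply/asboolP=> J [[]].
- apply/asboolP=> J idJ relJ; have [[_ JB] _] := idJ.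
  by apply: JB; [apply: uI | apply: vI].
move=> a u /asboolP uI; split; apply/asboolP=> J idJ relJ.
  exact: (idJ.2 a u (uI J idJ relJ)).1.
exact: (idJ.2 a u (uI J idJ relJ)).2.
Qed.

HB.instance Definition _ :=
  GRing.isZmodClosed.Build F env_ideal env_ideal_ideal.1.

(* The universal enveloping algebra of L: left modules over it are the
   same thing as L-modules. *)
Definition env : Type := Quotient.quot env_ideal.

HB.instance Definition _ := GRing.Zmodule.on env.
HB.instance Definition _ := Quotient.on env.

Definition env_proj (f : F) : env := \pi_(Quotient.quot env_ideal) f.

Lemma env_projP f g : env_proj f = env_proj g <-> f - g \in env_ideal.
Proof.
by rewrite (Quotient.idealrBE env_ideal); split=> [/eqP|/eqP].
Qed.

Lemma env_proj_repr (u : env) : env_proj (repr u) = u.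
Proof. exact: reprK. Qed.

Lemma env_projD : {morph env_proj : f g / f + g}.
Proof. by move=> f g; rewrite /env_proj !piE. Qed.

Lemma env_projN : {morph env_proj : f / - f}.
Proof. by move=> f; rewrite /env_proj !piE. Qed.

Definition env_one : env := env_proj 1.
Definition env_mul (u v : env) : env := env_proj (repr u * repr v).
Definition env_scale (c : K) (u : env) : env := env_proj (c *: repr u).

Lemma env_projM f g : env_proj (f * g) = env_mul (env_proj f) (env_proj g).
Proof.
have reprB h : h - repr (env_proj h) \in env_ideal.
  by apply/env_projP; rewrite env_proj_repr.
apply/env_projP; rewrite -[f * g](subrK (repr (env_proj f) * g)) -addrA.
rewrite -mulrBl -mulrBr rpredD //.
  exact: (env_ideal_ideal.2 g _ (reprB f)).2.
exact: (env_ideal_ideal.2 (repr (env_proj f)) _ (reprB g)).1.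
Qed.

Lemma env_projZ c f : env_proj (c *: f) = env_scale c (env_proj f).
Proof.
apply/env_projP; rewrite -scalerBr -mul_malgC.
have fB : f - repr (env_proj f) \in env_ideal.
  by apply/env_projP; rewrite env_proj_repr.
exact: (env_ideal_ideal.2 c%:MP _ fB).1.
Qed.

Fact env_mulA : associative env_mul.
Proof.
move=> u v w; rewrite -[u]env_proj_repr -[v]env_proj_repr -[w]env_proj_repr.
by rewrite -!env_projM mulrA.
Qed.

Fact env_mul1l : left_id env_one env_mul.
Proof. by move=> u; rewrite -[u]env_proj_repr -env_projM mul1r. Qed.

Fact env_mul1r : right_id env_one env_mul.
Proof. by move=> u; rewrite -[u]env_proj_repr -env_projM mulr1. Qed.

Fact env_mulDl : left_distributive env_mul +%R.
Proof.
move=> u v w; rewrite -[u]env_proj_repr -[v]env_proj_repr -[w]env_proj_repr.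
by rewrite -env_projD -!env_projM -env_projD mulrDl.
Qed.

Fact env_mulDr : right_distributive env_mul +%R.
Proof.
move=> u v w; rewrite -[u]env_proj_repr -[v]env_proj_repr -[w]env_proj_repr.
by rewrite -env_projD -!env_projM -env_projD mulrDr.
Qed.

(* The augmentation ideal is proper and contains the defining relations. *)
Fact env_one_neq0 : env_one != 0.
Proof.
pose e : {fmonom L} := mone.
have mcoeff1M (f g : F) : (f * g)@_e = f@_e * g@_e.
  exact: (mcoeff1g_is_multiplicative _ _).1.
have -> : 0 = env_proj 0 by rewrite /env_proj !piE.
apply/eqP=> /env_projP; rewrite subr0 => /asboolP one_in.
have letter0 x : (free_letter x)@_e = 0 :> K.
  by rewrite mcoeffU1 /e /mone /= -val_eqE /= fmoneE fmuE.
pose J : {pred F} := fun f => f@_e == 0.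
have JE f : (f \in J) = (f@_e == 0) by [].
suff: (1 : F) \in J by rewrite JE mcoeff1 eqxx oner_eq0.
apply: one_in => [|f].
  split=> [|a u].
    split=> [|f g]; rewrite !JE ?mcoeff0 // mcoeffB.
    by move=> /eqP-> /eqP->; rewrite subr0.
  move=> uJ; have u0 : u@_e = 0 by apply/eqP.
  split; apply/eqP.
    exact: etrans (mcoeff1M a u) (etrans (congr1 _ u0) (mulr0 _)).
  exact: etrans (mcoeff1M u a) (etrans (congr1 ( *%R^~ _) u0) (mul0r _)).
case=> [x y|c x|x y]; rewrite JE mcoeffB letter0.
- by rewrite mcoeffD !letter0 addr0 subr0.
- by rewrite mcoeffZ letter0 mulr0 subr0.
have M0 z t : (free_letter z * free_letter t)@_e = 0.
  exact: etrans (mcoeff1M _ _) (etrans (congr1 _ (letter0 t)) (mulr0 _)).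
have -> : (free_letter x * free_letter y - free_letter y * free_letter x)@_e
    = 0 - 0.
  exact: etrans (mcoeffB _ _ _) (congr2 (fun a b => a - b) (M0 x y) (M0 y x)).
by rewrite !subr0.
Qed.

HB.instance Definition _ := GRing.Zmodule_isNzRing.Build env
  env_mulA env_mul1l env_mul1r env_mulDl env_mulDr env_one_neq0.

Fact env_scaleA a b u : env_scale a (env_scale b u) = env_scale (a * b) u.
Proof. by rewrite -[u]env_proj_repr -!env_projZ scalerA. Qed.

Fact env_scale1 : left_id 1 env_scale.
Proof. by move=> u; rewrite -[u]env_proj_repr -env_projZ scale1r. Qed.

Fact env_scaleDr : right_distributive env_scale +%R.
Proof.
move=> a u v; rewrite -[u]env_proj_repr -[v]env_proj_repr.
by rewrite -env_projD -!env_projZ -env_projD scalerDr.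
Qed.

Fact env_scaleDl u : {morph env_scale^~ u : a b / a + b}.
Proof.
by move=> a b; rewrite -[u]env_proj_repr -!env_projZ -env_projD scalerDl.
Qed.

HB.instance Definition _ := GRing.Zmodule_isLmodule.Build K env
  env_scaleA env_scale1 env_scaleDr env_scaleDl.

Fact env_scaleAl c (u v : env) : c *: (u * v) = c *: u * v.
Proof.
rewrite -[u]env_proj_repr -[v]env_proj_repr.
by rewrite -[_ * _]env_projM -[LHS]env_projZ scalerAl env_projM env_projZ.
Qed.

HB.instance Definition _ := GRing.Lmodule_isLalgebra.Build K env env_scaleAl.

Fact env_scaleAr c (u v : env) : c *: (u * v) = u * (c *: v).
Proof.
have mul_malgCr (f : F) : f * c%:MP = c *: f.
  rewrite malgM_def malgZ_def fgmulgU.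
  by apply/eq_bigr=> m _; rewrite mulrC mulm1.
rewrite -[u]env_proj_repr -[v]env_proj_repr.
rewrite -[_ * _]env_projM -[LHS]env_projZ -mul_malgCr -mulrA mul_malgCr.
by rewrite env_projM env_projZ.
Qed.

HB.instance Definition _ := GRing.Lalgebra_isAlgebra.Build K env env_scaleAr.

Definition env_inj x : env := env_proj (free_letter x).

Lemma env_inj_is_linear : linear env_inj.
Proof.
have inE u v : env_rel (u - v) -> env_proj u = env_proj v.
  by move=> uv; apply/env_projP/asboolP=> J _; apply.
move=> c x y; rewrite /env_inj (inE _ _ (EnvD _ _)) env_projD.
by rewrite (inE _ _ (EnvZ _ _)) [in LHS]env_projZ.
Qed.

HB.instance Definition _ :=
  GRing.isLinear.Build K L env _ env_inj env_inj_is_linear.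

Lemma env_inj_lie x y :
  env_inj [lie x, y] = env_inj x * env_inj y - env_inj y * env_inj x.
Proof.
rewrite -[_ * _]env_projM -[X in _ - X]env_projM -env_projN -env_projD.
by apply/env_projP/asboolP=> J _; apply; apply: EnvLie.
Qed.

End EnvelopingAlgebra.

Section SimpleLieAlgebra.
Variables (K : fieldType) (L : finLieAlgType K).
Implicit Types (x y : L) (U V I H : {vspace L}).

Definition simple_lie : Prop :=
  (exists x y, [lie x, y] != 0) /\
  (forall I, (forall x y, y \in I -> [lie x, y] \in I) ->
     I = 0%VS \/ I = fullv).

Definition liev U V : {vspace L} :=
  <<[seq [lie u, v] | u <- vbasis U, v <- vbasis V]>>%VS.

Definition subalgebra H : Prop :=
  forall x y, x \in H -> y \in H -> [lie x, y] \in H.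

Definition nilpotent_subalgebra H : Prop :=
  exists m : nat, iter m (liev H) H = 0%VS.

Definition self_normalizing H : Prop :=
  forall x, (forall y, y \in H -> [lie x, y] \in H) -> x \in H.

Definition cartan_subalgebra H : Prop :=
  [/\ subalgebra H, nilpotent_subalgebra H & self_normalizing H].

Definition hstar H : vectType K := 'Hom(subvs_of H, K^o).

End SimpleLieAlgebra.

Section Roots.
Variables (K : fieldType) (L : finLieAlgType K) (H : {vspace L}).
Implicit Types (a : hstar H).

Definition root_space a (x : L) : Prop :=
  forall h : subvs_of H, [lie vsval h, x] = (a h : K) *: x.

Definition is_root a : Prop := a != 0 /\ exists2 x, x != 0 & root_space a x.

Variables (n : nat) (D : n.-tuple (hstar H)).

Definition simple_roots : Prop :=
  [/\ basis_of fullv D,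
      forall i, is_root (tnth D i) &
      forall a, is_root a -> exists c : 'I_n -> nat,
        a = \sum_i (c i)%:R *: tnth D i \/ a = - \sum_i (c i)%:R *: tnth D i].

Definition positive_root a : Prop :=
  is_root a /\ exists c : 'I_n -> nat, a = \sum_i (c i)%:R *: tnth D i.

Variables (hc : hstar H -> subvs_of H) (xp xm : hstar H -> L).

(* Being the bracket of vectors of weights a and - a and acting by 2 on
   xp a != 0, hc a is the coroot of a.  Values of hc, xp and xm at
   functionals that are not positive roots are irrelevant. *)
Definition root_vectors : Prop := forall a, positive_root a ->
  [/\ [/\ xp a != 0, xm a != 0, root_space a (xp a) & root_space (- a) (xm a)],
      [lie vsval (hc a), xp a] = 2 *: xp a,
      [lie vsval (hc a), xm a] = - (2 *: xm a) &
      [lie xp a, xm a] = vsval (hc a)].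

Definition dominant_integral (la : hstar H) : Prop :=
  forall i, exists m : nat, (la (hc (tnth D i)) : K) = m%:R.

Local Notation Ut := (env (current L)).
Local Notation "x '\act' p" := (env_inj (x \otimes p) : Ut)
  (at level 39, no associativity).

Variable la : hstar H.

(* An element u stands for the relation u w = 0. *)
Inductive local_weyl_rel : Ut -> Prop :=
| LWraise i (p : {poly K}) : local_weyl_rel (xp (tnth D i) \act p)
| LWcartan i (s : nat) :
    local_weyl_rel (vsval (hc (tnth D i)) \act 'X^s
      - (if s == 0%N then la (hc (tnth D i)) : K else 0)%:A)
| LWlower i (m : nat) : (la (hc (tnth D i)) : K) = m%:R ->
    local_weyl_rel ((xm (tnth D i) \act 1) ^+ m.+1).

Definition local_weyl : lmodType Ut := @quot_submod Ut Ut^o local_weyl_rel.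

Definition local_weyl_gen : local_weyl :=
  @quot_proj Ut Ut^o local_weyl_rel 1.

Local Notation w := local_weyl_gen.

(* Partitions are weakly decreasing lists of positive integers: the k-th part,
   for k >= 1, is nth 0%N s k.-1, and sumn (drop k s) is the sum of the parts of
   index at least k + 1. *)
Definition is_partition (s : seq nat) : bool :=
  sorted geq s && all (ltn 0) s.

Definition rectangular (s : seq nat) : Prop :=
  s = [::] \/ exists k m, [/\ 0 < k, 0 < m & s = nseq m k]%N.

Definition fat_hook (k1 s1 k2 s2 : nat) (s : seq nat) : Prop :=
  [/\ k2 < k1, 0 < k2, 0 < s1, 0 < s2 & s = nseq s1 k1 ++ nseq s2 k2]%N.

Definition special_fat_hook (s : seq nat) : Prop :=
  exists k1 s1 k2, fat_hook k1 s1 k2 1 s.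

Variable xi : hstar H -> seq nat.

Definition compatible : Prop := forall a, positive_root a ->
  is_partition (xi a) /\ (sumn (xi a))%:R = la (hc a) :> K.

Inductive V_rel : local_weyl -> Prop :=
| VRel a (s r k : nat) : positive_root a ->
    (0 < s)%N -> (0 < r)%N -> (0 < k)%N ->
    (1 + r * k + sumn (drop k (xi a)) <= s + r)%N ->
    V_rel (((xp a \act 'X) ^+ s * (xm a \act 1) ^+ (s + r)) *: w).

Definition V_module : lmodType Ut := quot_submod V_rel.

Inductive reduced_rel : local_weyl -> Prop :=
| RedTop a : positive_root a ->
    reduced_rel ((xm a \act 'X^(size (xi a))) *: w)
| RedHook a : positive_root a -> special_fat_hook (xi a) ->
    reduced_rel ((xm a \act 'X^((size (xi a)).-1))
      ^+ (nth 0%N (xi a) (size (xi a)).-1).+1 *: w).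

Definition reduced_module : lmodType Ut := quot_submod reduced_rel.

End Roots.

(* Main.v *)
Require Import Defs.
From HB Require Import structures.
From mathcomp Require Import all_boot all_order all_algebra.
From mathcomp Require Import ring zify.
From mathcomp Require Import boolp reals complex.

Set Implicit Arguments.
Unset Strict Implicit.
Unset Printing Implicit Defensive.

Import Order.TTheory GRing.Theory Num.Theory passmx.
Local Open Scope ring_scope.

(** Fix a positive root a and write f_p, h_p, e for the actions of
    x^-_a (x) t^p, h_a (x) t^p, x^+_a (x) t, and let N = la(h_a).  Garland's
    identity says that e^s f_0^(s+r) w is a nonzero multiple of the coefficient
    of u^s in (\sum_p f_p u^p)^r w, i.e. of a sum of monomials f_{p_1} ... f_{p_r} w
    with \sum_i p_i = s.  It reduces the equivalence of the two sets of relations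
    to counting: if f_p w = 0 for p >= m then s > r (m - 1) kills every monomial,
    and if moreover m = s_1 + 1 and f_{s_1}^(k_2+1) w = 0 it suffices that
    s > r (s_1 - 1) + k_2.  Whenever r is at least the largest part of the
    partition, s + r > N holds and f_0^(N+1) w = 0 applies.

    Garland's identity needs x^+_a (x) t^p and h_a (x) t^(p+1) to kill w, and the
    last step needs f_0^(N+1) w = 0, whereas the local Weyl module only imposes
    this for simple roots.  Both follow from sl_2-theory and the Killing form:
    x^+_a and x^-_a are iterated brackets of simple root vectors, h_a is a
    combination of simple coroots, and a weight la - c of the module satisfies
    (la - c, la - c) <= (la, la), which excludes the weight la - (N + 1) a. *)

(** * Representations of sl_2 *)

Definition nilpotent_at (V : zmodType) (g : V -> V) (v : V) : Prop :=
  exists k, iter k g v = 0.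

Section Sl2.
Variables (K : numFieldType) (V : lmodType K).

Definition sl2_triple (e f h : V -> V) : Prop :=
  [/\ forall v, e (f v) = f (e v) + h v,
      forall v, h (e v) = e (h v) + 2 *: e v &
      forall v, h (f v) = f (h v) - 2 *: f v].

Lemma sl2_opp (e f h : {linear V -> V}) :
  sl2_triple e f h -> sl2_triple f e (\- h).
Proof.
case=> ef he hf; split=> v /=.
- by rewrite ef addrK.
- by rewrite hf opprB linearN /= addrC.
- by rewrite he opprD linearN /=.
Qed.

Variables e f h : {linear V -> V}.
Hypothesis sl2 : sl2_triple e f h.
Implicit Types (v : V) (m : K) (j k : nat).

Lemma sl2_weight_e k v m :
  h v = m *: v -> h (iter k e v) = (m + 2 * k%:R) *: iter k e v.
Proof.
move=> hv; elim: k => [|k IH]; first by rewrite mulr0 addr0.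
case: sl2 => _ he _; rewrite iterS he IH linearZ /= -scalerDl.
by congr (_ *: _); rewrite -natr1; ring.
Qed.

Lemma sl2_weight_f k v m :
  h v = m *: v -> h (iter k f v) = (m - 2 * k%:R) *: iter k f v.
Proof.
move=> hv; elim: k => [|k IH]; first by rewrite mulr0 subr0.
case: sl2 => _ _ hf; rewrite iterS hf IH linearZ /= -scalerBl.
by congr (_ *: _); rewrite -natr1; ring.
Qed.

(** Moving [e] past successive factors [f] contributes the weights [m - 2 * i] for [i = 0, ..., k],
    with sum [(k + 1) * (m - k)]. *)
Lemma sl2_e_iter_f k v m : h v = m *: v ->
  e (iter k.+1 f v) = iter k.+1 f (e v) + (k.+1%:R * (m - k%:R)) *: iter k f v.
Proof.
case: sl2 => ef _ _ hv; elim: k => [|k IH].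
  by rewrite /= ef hv subr0 mul1r.
rewrite iterS ef IH (sl2_weight_f _ hv) linearD linearZ /= -addrA -scalerDl.
by congr (_ + _ *: _); rewrite -[k.+2%:R]natr1 -natr1; ring.
Qed.

Lemma sl2_iter_f_neq0 v j i : v != 0 -> e v = 0 -> h v = j%:R *: v ->
  (i <= j)%N -> iter i f v != 0.
Proof.
move=> v0 ev hv; elim: i => [|i IH] // ltij; apply/eqP=> fv0.
have := sl2_e_iter_f i hv; rewrite fv0 ev linear0 (iter_fix _ (linear0 f)) add0r.
move/esym/eqP; rewrite scaler_eq0 (negPf (IH (ltnW ltij))) orbF mulf_eq0.
by rewrite subr_eq0 eqr_nat (gtn_eqF ltij) orbF pnatr_eq0.
Qed.

Lemma nilpotent_at_last (g : {linear V -> V}) v : v != 0 -> nilpotent_at g v ->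
  exists2 k, iter k g v != 0 & g (iter k g v) = 0.
Proof.
move=> v0 nilv; pose P k := iter k g v == 0.
have exP : exists k, P k by case: nilv => k gv; exists k; apply/eqP.
case: (ex_minnP exP) => -[|k]; rewrite /P /=; first by rewrite (negPf v0).
move=> /eqP gk0 mink; exists k => //; apply/negP=> /mink.
by rewrite ltnn.
Qed.

Lemma sl2_highest_weight v m : v != 0 -> e v = 0 -> h v = m *: v ->
  nilpotent_at f v -> exists j : nat, m = j%:R.
Proof.
move=> v0 ev hv /(nilpotent_at_last v0)[j fj0 fSj0]; exists j.
have := sl2_e_iter_f j hv; rewrite iterS fSj0 ev linear0 (iter_fix _ (linear0 f)) add0r.
move/esym/eqP; rewrite scaler_eq0 (negPf fj0) orbF mulf_eq0 pnatr_eq0 subr_eq0.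
by move/eqP.
Qed.

(** The last non-zero [e^k v] is a highest weight vector, of weight [m + 2 * k = j]. *)
Lemma sl2_weight_string v m : v != 0 -> h v = m *: v ->
  nilpotent_at e v -> (forall k, nilpotent_at f (iter k e v)) ->
  exists k j : nat, m = j%:R - 2 * k%:R /\
    forall i, (i <= j)%N -> iter i f (iter k e v) != 0.
Proof.
move=> v0 hv /(nilpotent_at_last v0)[k ek0 eSk0] nilf.
have hek := sl2_weight_e k hv.
have [j mE] := sl2_highest_weight ek0 eSk0 hek (nilf k).
exists k, j; split; first by rewrite -mE addrK.
by move=> i; apply: sl2_iter_f_neq0; rewrite // -?mE.
Qed.

(** The vector found has the reflected weight [- m]; it survives because the top weight is
    [m + 2 * k >= k + m]. *)
Lemma sl2_reflect v (m : nat) : v != 0 -> h v = m%:R *: v ->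
  nilpotent_at e v -> (forall k, nilpotent_at f (iter k e v)) ->
  exists k, iter (k + m) f (iter k e v) != 0.
Proof.
move=> v0 hv nile nilf.
have [k [j [mE fN0]]] := sl2_weight_string v0 hv nile nilf.
exists k; apply: fN0; move/eqP: mE.
rewrite eq_sym subr_eq -natrM -natrD eqr_nat => /eqP->; lia.
Qed.

(* The vectors f^j e^j v satisfy a two-term recursion modulo e V, whose
   coefficients (j + 1) (m + j) never vanish. *)
Lemma sl2_e_onto (P : V -> Prop) v m :
  (forall c z, P z -> P (c *: z)) -> (forall y z, P y -> P z -> P (y + z)) ->
  (forall j, P (iter j.+1 f (iter j e v))) ->
  h v = m *: v -> nilpotent_at e v -> (forall j, m != - j%:R) ->
  exists2 z, P z & v = e z.
Proof.
move=> PZ PD Pf hv [N eN0] mN.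
suff: forall j k, (k + j = N)%N ->
    exists2 z, P z & iter k f (iter k e v) = e z.
  by move/(_ N 0 (add0n N)).
elim=> [|j IH] k kjN.
  exists (0 *: iter 1 f (iter 0 e v)); first exact: PZ (Pf 0).
  move: kjN eN0; rewrite addn0 => <- ->.
  by rewrite (iter_fix _ (linear0 f)) scale0r linear0.
have [|z Pz zE] := IH k.+1; first by rewrite addSnnS.
have c0 : k.+1%:R * (m + k%:R) != 0.
  by rewrite mulf_neq0 ?pnatr_eq0 // addr_eq0.
have := sl2_e_iter_f k (sl2_weight_e k hv).
rewrite -[e (iter k e v)]iterS zE.
have -> : m + 2 * k%:R - k%:R = m + k%:R by ring.
move=> eE.
exists ((k.+1%:R * (m + k%:R))^-1 *: (iter k.+1 f (iter k e v) + (-1) *: z)).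
  by apply/PZ/PD; [apply: Pf | apply: PZ].
rewrite linearZ linearD /= scaleN1r linearN eE.
by rewrite addrAC subrr add0r scalerA mulVf // scale1r.
Qed.

End Sl2.

(** * Endomorphisms of finite-dimensional spaces *)

Section EndomorphismMatrix.
Variables (K : fieldType) (V : vectType K).
Local Notation b := (vbasis {:V}).

Definition end_mx (g : V -> V) : 'M[K]_(\dim {:V}) :=
  mxof b b (linfun g).

Let basb : basis_of {:V} b := vbasisP _.

Lemma end_mx_comp (g1 g2 : {linear V -> V}) :
  end_mx (g1 \o g2) = end_mx g2 *m end_mx g1.
Proof.
rewrite /end_mx -mxof_comp //; congr mxof.
by apply/lfunP=> v; rewrite lfunE /= comp_lfunE !lfunE.
Qed.

Lemma end_mx_eigenvalueP (g : {linear V -> V}) c :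
  reflect (exists2 v, v != 0 & g v = c *: v) (eigenvalue (end_mx g) c).
Proof.
apply: (iffP eigenvalueP) => [[u uE u0] | [v v0 vE]].
  exists (vecof b u); first by rewrite vecof_eq0.
  have := hom_vecof b basb (linfun g) u.
  by rewrite lfunE uE linearZ.
exists (rVof b v); last by rewrite rVof_eq0.
by rewrite -rVof_app // lfunE /= vE linearZ.
Qed.

End EndomorphismMatrix.

(** Otherwise every [c + d * k] is an eigenvalue of [h]; these are distinct in characteristic 0, and
    [size p] of them are too many roots for the characteristic polynomial [p]. *)
Lemma shift_nilpotent (K : numFieldType) (V : vectType K)
    (h e : {linear V -> V}) (c d : K) (v : V) : d != 0 ->
  (forall u, h (e u) = e (h u) + d *: e u) -> h v = c *: v -> nilpotent_at e v.
Proof.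
move=> d0 he hv; apply: contrapT => nilN.
have ev0 k : iter k e v != 0 by apply/eqP=> ek0; apply: nilN; exists k.
have hev k : h (iter k e v) = (c + d * k%:R) *: iter k e v.
  elim: k => [|k IH]; first by rewrite mulr0 addr0.
  by rewrite iterS he IH linearZ /= -scalerDl -natr1; congr (_ *: _); ring.
pose p := char_poly (end_mx h).
pose rs := [seq c + d * k%:R | k <- iota 0 (size p)].
have p0 : p != 0 by rewrite monic_neq0 // char_poly_monic.
have rootp : all (root p) rs.
  apply/allP=> _ /mapP[k _ ->]; rewrite -eigenvalue_root_char.
  by apply/end_mx_eigenvalueP; exists (iter k e v).
have uniqrs : uniq rs.
  rewrite map_inj_uniq ?iota_uniq // => i j /addrI /(mulfI d0) /eqP.
  by rewrite eqr_nat => /eqP.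
by have := max_poly_roots p0 rootp uniqrs; rewrite size_map size_iota ltnn.
Qed.

(** The eigenvalues of [A *m A] are squares of eigenvalues of [A], so the trace is a sum of
    non-negative terms containing [a ^+ 2 > 0]. *)
Lemma trace_sqr_gt0 (K : numClosedFieldType) m (A : 'M[K]_m) a :
  (forall c, eigenvalue A c -> 0 <= c ^+ 2) -> eigenvalue A a -> a != 0 ->
  0 < \tr (A *m A).
Proof.
move=> Age0 Aa a0; set B := A *m A.
have eigB c : eigenvalue B c -> 0 <= c.
  case/eigenvalueP=> v vB v0; rewrite -[c]sqrtCK; set s := sqrtC c.
  have sE : c = s ^+ 2 by rewrite sqrtCK.
  (* As [v (A - s) (A + s) = 0], either [v] has eigenvalue [s] or [v (A - s)] has eigenvalue
     [- s]. *)
  have [vA | vA] := eqVneq (v *m A - s *: v) 0.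
    apply/Age0/eigenvalueP; exists v => //; apply/eqP.
    by rewrite -subr_eq0 vA.
  rewrite -sqrrN; apply/Age0/eigenvalueP; exists (v *m A - s *: v) => //.
  rewrite mulmxBl -mulmxA vB -scalemxAl sE expr2 scalerBr scalerA.
  by rewrite scaleNr mulNr scaleNr opprK addrC.
have Baa : eigenvalue B (a ^+ 2).
  case/eigenvalueP: Aa => v vA v0; apply/eigenvalueP; exists v => //.
  by rewrite mulmxA vA -scalemxAl vA scalerA.
have m0 : (0 < m)%N.
  case: m A a Aa a0 @B Baa {Age0 eigB} => // A a Aa.
  by case/eigenvalueP: Aa => v _; rewrite [v]thinmx0 eqxx.
have [rs rsE] := closed_field_poly_normal (char_poly B).
move: rsE; rewrite (monicP (char_poly_monic B)) scale1r => rsE.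
have sz : size rs = m.
  by apply: succn_inj; rewrite -(size_char_poly B) rsE size_prod_XsubC.
have eigrs c : c \in rs -> eigenvalue B c.
  by rewrite eigenvalue_root_char rsE root_prod_XsubC.
have := char_poly_trace B m0; rewrite rsE -[in X in _`_X]sz.
rewrite coefPn_prod_XsubC ?sz -?lt0n // => /oppr_inj <-.
have a2 : a ^+ 2 \in rs.
  by rewrite -root_prod_XsubC -rsE -eigenvalue_root_char.
rewrite (big_rem _ a2) /= ltr_wpDr //.
  rewrite big_seq; apply: sumr_ge0 => c /mem_rem; move/eigrs; exact: eigB.
by rewrite lt_neqAle eq_sym expf_neq0 // eigB.
Qed.

(** * Actions of Lie algebras *)

Section LieAction.
Variables (K : fieldType) (M : lieAlgType K).

Definition lie_action (V : lmodType K) (r : M -> {linear V -> V}) : Prop :=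
  (forall v, linear (r^~ v)) /\
  (forall x y v, r [lie x, y] v = r x (r y v) - r y (r x v)).

Definition ad (x : M) : M -> M := lie x.

Fact ad_is_linear x : linear (ad x).
Proof. by move=> c y z; rewrite /ad lieDr lieZr. Qed.

HB.instance Definition _ x :=
  GRing.isLinear.Build K M M _ (ad x) (ad_is_linear x).

Lemma lie_derivation (x y z : M) :
  [lie x, [lie y, z]] = [lie [lie x, y], z] + [lie y, [lie x, z]].
Proof.
apply/eqP; rewrite -subr_eq0 opprD addrA; apply/eqP.
rewrite (lieC [lie x, y] z) opprK addrAC.
have := lie_jacobi x y z; rewrite (lieC z x).
have -> : [lie y, - [lie x, z]] = - [lie y, [lie x, z]].
  by rewrite -scaleN1r lieZr scaleN1r.
by [].
Qed.

Lemma ad_action : lie_action (fun x => ad x : {linear M -> M}).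
Proof.
split=> [v c x y|x y v] /=; first by rewrite /ad lieDl lieZl.
by rewrite /ad (lie_derivation x) addrK.
Qed.

Section Theory.
Variables (V : lmodType K) (r : M -> {linear V -> V}).
Hypothesis actr : lie_action r.

Lemma actionD x y v : r (x + y) v = r x v + r y v.
Proof. by have := actr.1 v 1 x y; rewrite !scale1r. Qed.

Lemma action0 v : r 0 v = 0.
Proof. by apply: (addrI (r 0 v)); rewrite -actionD !addr0. Qed.

Lemma actionZ c x v : r (c *: x) v = c *: r x v.
Proof. by have := actr.1 v c x 0; rewrite !addr0 action0 addr0. Qed.

Lemma actionN x v : r (- x) v = - r x v.
Proof. by rewrite -[- x]scaleN1r actionZ scaleN1r. Qed.

Lemma action_sum (I : Type) (s : seq I) (P : pred I) (F : I -> M) v :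
  r (\sum_(i <- s | P i) F i) v = \sum_(i <- s | P i) r (F i) v.
Proof.
by apply: (big_morph (fun x => r x v)) => [x y|]; rewrite ?actionD ?action0.
Qed.

Lemma action_lie x y v : r [lie x, y] v = r x (r y v) - r y (r x v).
Proof. exact: actr.2. Qed.

Lemma actionC x y v : r x (r y v) = r y (r x v) + r [lie x, y] v.
Proof. by rewrite action_lie addrC subrK. Qed.

(** By the Leibniz rule [x^(a+b) (y v)] is a sum of terms [((ad x)^i y) (x^j v)] with
    [i + j = a + b], so [i >= a] or [j >= b]. Induction on [a + b] avoids the binomial
    coefficients. *)
Lemma nilpotent_at_action x y v :
  nilpotent_at (ad x) y -> nilpotent_at (r x) v -> nilpotent_at (r x) (r y v).
Proof.
case=> a xay [b xbv]; exists (a + b)%N.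
have [m abm] := ubnP (a + b)%N.
elim: m => // m IH in a b y v xay xbv abm *.
case: a => [|a] in xay abm *.
  rewrite [y](_ : _ = 0) // action0; exact/iter_fix/linear0.
case: b => [|b] in xbv abm *.
  rewrite [v](_ : _ = 0) // !linear0; exact/iter_fix/linear0.
rewrite addSn iterSr actionC addrC.
have iterD k (g : {linear V -> V}) u1 u2 : iter k g (u1 + u2) = iter k g u1 + iter k g u2.
  by elim: k => //= k ->; rewrite linearD.
rewrite iterD IH ?add0r -?iterSr //.
by rewrite addnS -addSn IH // -?iterSr // addSn -addnS.
Qed.

End Theory.
End LieAction.

Lemma sl2_action (K : numFieldType) (M : lieAlgType K) (V : lmodType K)
    (r : M -> {linear V -> V}) (x y h : M) : lie_action r ->
  [lie x, y] = h -> [lie h, x] = 2 *: x -> [lie h, y] = - (2 *: y) ->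
  sl2_triple (r x) (r y) (r h).
Proof.
move=> actr xy hx hy; split=> v; rewrite (actionC actr).
- by rewrite xy.
- by rewrite hx actionZ.
- by rewrite hy actionN // actionZ.
Qed.

(** * The Killing form and root spaces *)

Section KillingForm.
Variables (K : fieldType) (L : finLieAlgType K).
Implicit Types x y z : L.

Definition killing x y : K := \tr (end_mx (ad x) *m end_mx (ad y)).

Lemma killingC x y : killing x y = killing y x.
Proof. exact: mxtrace_mulC. Qed.

Lemma killingZr c x y : killing x (c *: y) = c * killing x y.
Proof.
rewrite /killing /end_mx -mxtraceZ scalemxAr -linearZ.
congr (\tr (_ *m mxof _ _ _)).
by apply/lfunP=> z; rewrite scale_lfunE !lfunE /= /ad lieZl.
Qed.

Lemma end_mx_ad_lie x y : end_mx (ad [lie x, y]) =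
  end_mx (ad y) *m end_mx (ad x) - end_mx (ad x) *m end_mx (ad y).
Proof.
rewrite -!end_mx_comp /end_mx -linearB; congr mxof.
apply/lfunP=> z; rewrite add_lfunE opp_lfunE !lfunE /=.
exact: (action_lie (ad_action L)).
Qed.

Lemma killing_lie x y z : killing [lie x, y] z = killing x [lie y, z].
Proof.
rewrite /killing !end_mx_ad_lie mulmxBl mulmxBr !linearB /=.
by congr (_ - _); rewrite -mulmxA // mxtrace_mulC mulmxA.
Qed.

End KillingForm.

Section RootSpaces.
Variables (K : fieldType) (L : finLieAlgType K) (H : {vspace L}).
Implicit Types (a b : hstar H) (x y : L) (h : subvs_of H).

Lemma root_space_lie a b x y :
  root_space a x -> root_space b y -> root_space (a + b) [lie x, y].
Proof.
move=> ax by_ h; rewrite lie_derivation ax by_ lieZl lieZr.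
by rewrite add_lfunE scalerDl.
Qed.

Lemma root_spaceZ a c x : root_space a x -> root_space a (c *: x).
Proof. by move=> ax h; rewrite lieZr ax !scalerA mulrC. Qed.

Lemma root_spaceD a x y :
  root_space a x -> root_space a y -> root_space a (x + y).
Proof. by move=> ax ay h; rewrite lieDr ax ay scalerDr. Qed.

Lemma root_space_iter a b k x y : root_space a x -> root_space b y ->
  root_space (a *+ k + b) (iter k (ad x) y).
Proof.
move=> ax by_; elim: k => [|k IH]; first by rewrite add0r.
by rewrite mulrS -addrA; apply: root_space_lie.
Qed.

(** A vector of weight 0 centralises [H], hence normalises it, and [H] is self-normalising. *)
Lemma root_space0_cartan x : cartan_subalgebra H -> root_space (0 : hstar H) x -> x \in H.
Proof.
case=> _ _ selfH x0; apply: selfH => y yH.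
by have := x0 (vsproj H y); rewrite vsprojK // lieC lfunE scale0r => /eqP;
  rewrite oppr_eq0 => /eqP->; exact: mem0v.
Qed.

Lemma hstar_separates h : (forall a, a h = 0) -> h = 0.
Proof.
move=> h0; apply/eqP; rewrite -(rVof_eq0 (vbasisP _)); apply/eqP/rowP => i.
rewrite !mxE; have := h0 (linfun (coord (vbasis fullv) i : _ -> K^o)).
by rewrite lfunE.
Qed.

End RootSpaces.

(** * Positive roots and integrability *)

(** This is [sl2_e_onto] in the adjoint representation: each [f^(j+1) e^j x] has weight [a - b], and
    [ad e] is nilpotent at [x] by finite dimension. *)
Lemma root_descent (K : numFieldType) (L : finLieAlgType K) (H : {vspace L})
    (a b : hstar H) (h : subvs_of H) (e f x : L) :
  [lie e, f] = vsval h -> [lie vsval h, e] = 2 *: e ->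
  [lie vsval h, f] = - (2 *: f) ->
  root_space b e -> root_space (- b) f -> root_space a x ->
  (forall j : nat, a h != - j%:R :> K) ->
  exists2 z, root_space (a - b) z & x = [lie e, z].
Proof.
move=> ef he hf be bf ax aN.
have sl2 := sl2_action (ad_action L) ef he hf.
apply: (sl2_e_onto sl2 _ _ _ (ax h)) => [c z|y z|j||] //.
- exact: root_spaceZ.
- exact: root_spaceD.
- have -> : a - b = (- b) *+ j.+1 + (b *+ j + a).
    by rewrite mulNrn mulrS opprD addrA subrK addrC.
  by do 2!apply: root_space_iter => //.
have two0 : (2 : K) != 0 by rewrite pnatr_eq0.
apply: (@shift_nilpotent _ L (ad (vsval h)) (ad e) _ _ _ two0 _ (ax h)) => u.
by case: sl2.
Qed.

Section RootSystem.
Variables (K : numClosedFieldType) (L : finLieAlgType K) (H : {vspace L}).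
Variables (n : nat) (D : n.-tuple (hstar H)).
Variables (hc : hstar H -> subvs_of H) (xp xm : hstar H -> L).
Hypotheses (simD : simple_roots D) (rvec : root_vectors D hc xp xm).
Hypothesis cartH : cartan_subalgebra H.
Implicit Types (a : hstar H) (c : 'I_n -> nat).

Local Notation A := (tnth D).
Local Notation "a @@ h" := ((a : hstar H) (h : subvs_of H) : K) (at level 30).

Definition nat_comb c : hstar H := \sum_i (c i)%:R *: A i.
Definition simple_index (i : 'I_n) : 'I_n -> nat := fun j => (j == i) : nat.

Lemma nat_combE c h : nat_comb c @@ h = \sum_i (c i)%:R * (A i @@ h).
Proof. by rewrite sum_lfunE; apply: eq_bigr => i _; rewrite scale_lfunE. Qed.

Lemma nat_combD c c' : nat_comb (fun j => c j + c' j)%N = nat_comb c + nat_comb c'.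
Proof. by rewrite -big_split; apply: eq_bigr => i _; rewrite natrD scalerDl. Qed.

Lemma nat_comb_simple i : nat_comb (simple_index i) = A i.
Proof.
rewrite /nat_comb (bigD1 i) //= /simple_index eqxx scale1r big1 ?addr0 //.
by move=> j /negPf->; rewrite scale0r.
Qed.

Lemma simple_basis_inj (u v : 'I_n -> K) :
  \sum_i u i *: A i = \sum_i v i *: A i -> u =1 v.
Proof.
have [/basis_free/freeP freeD _ _] := simD; move=> uv i.
apply/eqP; rewrite -subr_eq0; apply/eqP.
apply: (freeD (fun i => u i - v i)); rewrite -[RHS](subrr (\sum_i u i *: A i)).
rewrite [in X in _ = _ - X]uv -sumrB.
by apply: eq_bigr => j _; rewrite scalerBl (tnth_nth 0).
Qed.

Lemma nat_comb_inj : injective nat_comb.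
Proof.
move=> c c' /simple_basis_inj cc'; apply/funext => i.
by apply/eqP; rewrite -(eqr_nat K) cc'.
Qed.

Lemma positive_simple i : positive_root D (A i).
Proof.
have [_ rootD _] := simD; split; first exact: rootD.
by exists (simple_index i); rewrite -nat_comb_simple.
Qed.

Lemma coroot_sl2 a : positive_root D a ->
  sl2_triple (ad (xp a)) (ad (xm a)) (ad (vsval (hc a))).
Proof.
by case/rvec=> _ hx hy xy; apply: (sl2_action (ad_action L)).
Qed.

Lemma coroot_pairing a : positive_root D a -> a @@ hc a = 2.
Proof.
case/rvec=> [[x0 _ ax _]] hx _ _; apply/eqP; rewrite -subr_eq0.
suff: (a @@ hc a - 2) *: xp a == 0 by rewrite scaler_eq0 (negPf x0) orbF.
by rewrite scalerBl -ax hx subrr.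
Qed.

(** Finite dimension makes [ad (xp a)] and [ad (xm a)] nilpotent at weight vectors, so sl_2-theory
    yields an integer. *)
Lemma ad_coroot_eigenvalue a (m : K) (v : L) : positive_root D a -> v != 0 ->
  [lie vsval (hc a), v] = m *: v -> exists k j : nat, m = j%:R - 2 * k%:R.
Proof.
move=> posa v0 vE; have sl2 := coroot_sl2 posa.
have two0 : (2 : K) != 0 by rewrite pnatr_eq0.
have ntwo0 : (- 2 : K) != 0 by rewrite oppr_eq0.
have [_ he hf] := sl2.
have [|k|k [j [cE _]]] := sl2_weight_string sl2 v0 vE.
- exact: (shift_nilpotent two0 he vE).
- apply: (@shift_nilpotent _ L (ad (vsval (hc a))) (ad (xm a)) _ _ _ ntwo0 _
    (sl2_weight_e sl2 k vE)) => u.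
  by rewrite scaleNr; exact: hf.
by exists k, j.
Qed.

(* Up to a factor 2 this is the inverse of (a, a): the Killing form identifies a
   with hc a / root_norm a. *)
Definition root_norm a : K := killing (xp a) (xm a).

Lemma killing_coroot a h : positive_root D a ->
  killing (vsval (hc a)) (vsval h) = a @@ h * root_norm a.
Proof.
case/rvec=> [[_ _ _ ay]] _ _ <-; rewrite killing_lie lieC ay.
by rewrite opp_lfunE scaleNr opprK killingZr.
Qed.

(** The Killing form of [hc a] with itself is [2 * root_norm a]; it is also the trace of the square
    of [ad (hc a)], whose eigenvalues are integers, among them 2 at [xp a]. *)
Lemma root_norm_gt0 a : positive_root D a -> 0 < root_norm a.
Proof.
move=> posa; have := killing_coroot (hc a) posa.
rewrite coroot_pairing // => kE.
suff: 0 < killing (vsval (hc a)) (vsval (hc a)).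
  by rewrite kE pmulr_rgt0 // ltr0n.
have [[x0 _ _ _] hx _ _] := rvec posa.
apply: (@trace_sqr_gt0 _ _ _ 2) => [c||].
- case/end_mx_eigenvalueP=> v v0 /(ad_coroot_eigenvalue posa v0)[k [j ->]].
  by rewrite real_exprn_even_ge0 // rpredB ?rpredM ?realn.
- by apply/end_mx_eigenvalueP; exists (xp a).
by rewrite pnatr_eq0.
Qed.

(** Both sides are the Killing form of [hc a] and [hc b]. *)
Lemma coroot_symmetry a b : positive_root D a -> positive_root D b ->
  root_norm a * (a @@ hc b) = root_norm b * (b @@ hc a).
Proof.
move=> posa posb; rewrite mulrC -killing_coroot // killingC.
by rewrite killing_coroot // mulrC.
Qed.

(* Otherwise (a, a) = \sum_i c_i (a, A i) <= 0. *)
Lemma positive_root_not_antidominant a : positive_root D a ->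
  exists i, forall j : nat, a @@ hc (A i) != - j%:R.
Proof.
move=> posa; apply: contrapT => /forallNP anti.
have anti_le0 i : a @@ hc (A i) <= 0.
  have [j aj] : exists j : nat, a @@ hc (A i) = - j%:R.
    by apply: contrapT => /forallNP aN; apply: (anti i) => j; apply/eqP/aN.
  by rewrite aj oppr_le0 ler0n.
have := coroot_pairing posa; have [_ [c ac]] := posa.
rewrite {1}ac nat_combE => /eqP; apply/negP; rewrite lt_eqF //.
apply: (@le_lt_trans _ _ 0); last by rewrite ltr0n.
apply: sumr_le0 => i _; rewrite mulr_ge0_le0 ?ler0n //.
rewrite -(pmulr_rle0 _ (root_norm_gt0 (positive_simple i))).
rewrite (coroot_symmetry (positive_simple i) posa).
by rewrite pmulr_rle0 // root_norm_gt0.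
Qed.

(** As [hc a / root_norm a] represents [a] in the Killing form, it is linear in [a]; this is checked
    by evaluating each simple root on both sides. *)
Lemma coroot_comb c : positive_root D (nat_comb c) ->
  hc (nat_comb c) = root_norm (nat_comb c) *:
    \sum_i ((c i)%:R / root_norm (A i)) *: hc (A i).
Proof.
set a := nat_comb c => posa; apply/eqP; rewrite -subr_eq0; apply/eqP.
apply: hstar_separates => b; have [basD _ _] := simD.
rewrite (coord_basis basD (memvf b)) sum_lfunE big1 // => j _.
rewrite scale_lfunE -(tnth_nth 0 D j); apply/eqP.
rewrite mulf_eq0; apply/orP; right; apply/eqP.
rewrite linearB linearZ linear_sum /=.
have nz i : root_norm (A i) != 0.
  by rewrite gt_eqF // root_norm_gt0 //; exact: positive_simple.
apply: (mulfI (nz j)); rewrite mulr0 mulrBr (coroot_symmetry (positive_simple j) posa).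
rewrite mulrCA -mulrBr nat_combE mulr_sumr -sumrB big1 ?mulr0 // => i _.
rewrite linearZ /= mulrCA (coroot_symmetry (positive_simple j) (positive_simple i)).
by rewrite mulrA divfK // subrr.
Qed.

Definition simple_vec (s : bool) (i : 'I_n) : L :=
  if s then xm (A i) else xp (A i).

Lemma simple_vec_root_space (s : bool) i :
  root_space ((-1) ^+ s *: A i) (simple_vec s i).
Proof.
have [[_ _ ax ay] _ _ _] := rvec (positive_simple i).
by case: s; rewrite ?scaleN1r ?scale1r.
Qed.

(** For an [i] with [a(hc (A i))] not in [{0, -1, -2, ...}], sl_2-theory makes the bracket with
    [simple_vec s i] map the root space of [a - A i] onto that of [a], up to the sign given by
    [s]. *)
Lemma positive_root_descent a : positive_root D a -> exists i,
  (a = A i \/ positive_root D (a - A i)) /\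
  forall (s : bool) x, root_space ((-1) ^+ s *: a) x ->
    exists2 z, root_space ((-1) ^+ s *: (a - A i)) z & x = [lie simple_vec s i, z].
Proof.
move=> posa; have [i aiN] := positive_root_not_antidominant posa.
have [[_ _ eA fA] he hf ef] := rvec (positive_simple i).
have desc (s : bool) x : root_space ((-1) ^+ s *: a) x ->
    exists2 z, root_space ((-1) ^+ s *: (a - A i)) z & x = [lie simple_vec s i, z].
  case: s; rewrite ?scaleN1r ?scale1r => ax; last exact: (root_descent ef).
  rewrite opprD; apply: (@root_descent _ _ _ _ _ (- hc (A i)) _ (xp (A i))) => //.
  - by rewrite lieC ef linearN.
  - by rewrite linearN -scaleN1r lieZl hf scaleN1r opprK.
  - by rewrite linearN -scaleN1r lieZl he scaleN1r.
  - by rewrite opprK.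
  by move=> j; rewrite opp_lfunE linearN opprK.
exists i; split=> //.
have [[x0 _ ax _] _ _ _] := rvec posa.
have [|z az xz] := desc false (xp a); first by rewrite scale1r.
have z0 : z != 0 by apply: contraNneq x0 => z0; rewrite xz z0 lie0r.
rewrite scale1r in az.
have [->|ai0] := eqVneq a (A i); [by left | right].
have rootai : is_root (a - A i) by split; [rewrite subr_eq0 | exists z].
(* If [a - A i] were a negative root, the coefficients of [a] and of [A i - a] would add up to those
   of [A i], so [a] would be 0 or [A i]. *)
split=> //; have [_ _ /(_ _ rootai)[c [->|ac]]] := simD; first by exists c.
have [roota [c' aE]] := posa.
have cc : (fun j => c j + c' j)%N = simple_index i.
  apply: nat_comb_inj; rewrite nat_combD nat_comb_simple.
  by rewrite -[nat_comb c]opprK -ac opprB aE -[\sum_i _]/(nat_comb c') subrK.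
case/negP: ai0; rewrite aE -[\sum_i _]/(nat_comb c') -nat_comb_simple.
have c'i j : j != i -> c' j = 0%N.
  by move=> ji; have /(congr1 (@^~ j)) := cc; rewrite /simple_index (negPf ji); lia.
have c'E : nat_comb c' = (c' i)%:R *: A i.
  rewrite /nat_comb (bigD1 i) //= big1 ?addr0 // => j /c'i->.
  by rewrite scale0r.
have := congr1 (@^~ i) cc; rewrite /simple_index eqxx /=.
case: (c' i) c'E => [|m] c'E cc1.
  by have [] := roota; rewrite aE -[\sum_i _]/(nat_comb c') c'E scale0r eqxx.
by rewrite c'E (_ : m.+1 = 1%N) ?nat_comb_simple ?scale1r //; lia.
Qed.

(** Induction on the height [\sum_i c i] through [positive_root_descent]. *)
Lemma positive_root_ind (s : bool) (P : ('I_n -> nat) -> L -> Prop) :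
  (forall i (k : K), P (simple_index i) (k *: simple_vec s i)) ->
  (forall c i z, P c z ->
     P (fun j => simple_index i j + c j)%N [lie simple_vec s i, z]) ->
  forall c x, positive_root D (nat_comb c) ->
    root_space ((-1) ^+ s *: nat_comb c) x -> P c x.
Proof.
move=> P1 PS c; have [m] := ubnP (\sum_i c i)%N.
elim: m => // m IH in c * => cm x posc cx.
have [i [ci /(_ s x cx)[z cz ->]]] := positive_root_descent posc.
case: ci => [cE|posci].
  have -> : c = simple_index i by apply: nat_comb_inj; rewrite nat_comb_simple.
  (* At a simple root the remaining factor [z] has weight 0, so it lies in [H] and only rescales
     [simple_vec s i]. *)
  have /root_space0_cartan : root_space (0 : hstar H) z.
    by move: cz; rewrite cE subrr scaler0.
  move=> /(_ cartH) zH; rewrite lieC -(vsprojK zH) simple_vec_root_space -scaleNr.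
  exact: P1.
have [_ [c' cE]] := posci.
have {}cE : c = (fun j => simple_index i j + c' j)%N.
  apply: nat_comb_inj; rewrite nat_combD nat_comb_simple -[nat_comb c'](cE).
  by rewrite addrC subrK.
have c'E : nat_comb c - A i = nat_comb c'.
  by rewrite cE nat_combD nat_comb_simple addrC addKr.
rewrite c'E in cz posci; rewrite cE; apply: PS.
apply: IH => //; move: cm; rewrite ltnS cE; apply: leq_trans.
rewrite big_split -[X in (X < _)%N]add0n ltn_add2r (bigD1 i) //=.
by rewrite /simple_index eqxx.
Qed.

(** A non-zero bracket would make [A i - A j] a root, whose coefficients have mixed signs. *)
Lemma simple_root_brackets i j : i != j -> [lie xp (A i), xm (A j)] = 0.
Proof.
move=> ij; apply/eqP; apply: contraNT ij => x0.
have [_ rootD combD] := simD.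
have [[_ _ ax _] _ _ _] := rvec (positive_simple i).
have [[_ _ _ ay] _ _ _] := rvec (positive_simple j).
have [Aij|Aij0] := eqVneq (A i - A j) 0.
  move/eqP: Aij; rewrite subr_eq0 -!nat_comb_simple => /eqP/nat_comb_inj.
  move/(congr1 (@^~ i)); rewrite /simple_index eqxx.
  by case: eqP => // ->.
have /combD[c [cE|cE]] : is_root (A i - A j).
- by split=> //; exists [lie xp (A i), xm (A j)] => //; exact: root_space_lie.
- have /nat_comb_inj/(congr1 (@^~ j)) :
      nat_comb (simple_index i) = nat_comb (fun k => simple_index j k + c k)%N.
    by rewrite nat_combD !nat_comb_simple -[nat_comb c](cE) addrC subrK.
  by rewrite /simple_index eqxx eq_sym; case: eqP.
have /nat_comb_inj/(congr1 (@^~ i)) :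
    nat_comb (simple_index j) = nat_comb (fun k => simple_index i k + c k)%N.
  by rewrite nat_combD !nat_comb_simple -[nat_comb c]opprK -cE opprB addrC subrK.
by rewrite /simple_index eqxx eq_sym; case: eqP.
Qed.

(** * Integrability of highest weight modules *)

Section Integrability.
Variables (V : lmodType K) (r : L -> {linear V -> V}) (w : V) (la : hstar H).
Hypothesis actr : lie_action r.
Hypothesis w_raise : forall i, r (xp (A i)) w = 0.
Hypothesis w_weight : forall i,
  r (vsval (hc (A i))) w = (la @@ hc (A i)) *: w.
Hypothesis w_lower : forall i, exists2 m : nat, la @@ hc (A i) = m%:R &
  iter m.+1 (r (xm (A i))) w = 0.

(* [lower_span c v]: v is a linear combination of the products of c_i copies of
   each simple lowering operator, in any order, applied to w. *)
Inductive lower_span : ('I_n -> nat) -> V -> Prop :=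
| LowerGen : lower_span (fun _ => 0%N) w
| LowerStep c i v : lower_span c v ->
    lower_span (fun j => simple_index i j + c j)%N (r (xm (A i)) v)
| LowerZero c : lower_span c 0
| LowerLin c (k : K) u v : lower_span c u -> lower_span c v ->
    lower_span c (k *: u + v).

Lemma lower_spanD c u v : lower_span c u -> lower_span c v -> lower_span c (u + v).
Proof. by move=> cu cv; rewrite -[u]scale1r; apply: LowerLin. Qed.

Lemma lower_spanZ c (k : K) v : lower_span c v -> lower_span c (k *: v).
Proof. by move=> cv; rewrite -[_ *: _]addr0; apply/LowerLin/LowerZero. Qed.

Lemma lower_span_weight c v i : lower_span c v ->
  r (vsval (hc (A i))) v = ((la - nat_comb c) @@ hc (A i)) *: v.
Proof.
elim=> {c v} [|c j v _ IH|c|c k u v _ IHu _ IHv].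
- by rewrite [nat_comb _]big1 ?subr0 // => j _; rewrite scale0r.
- have [[_ _ _ ay] _ _ _] := rvec (positive_simple j).
  rewrite (actionC actr) IH ay actionZ // linearZ /= -scalerDl; congr (_ *: _).
  by rewrite nat_combD nat_comb_simple opprD !add_lfunE opp_lfunE addrCA addrC.
- by rewrite linear0 scaler0.
by rewrite linearP /= IHu IHv scalerDr !scalerA mulrC.
Qed.

(** [xp (A i)] is moved to the right until it kills [w]; it fails to commute only with [xm (A i)],
    where the commutator acts by a scalar. For [c i = 0] the truncated subtraction would be wrong,
    so this case is separate. *)
Lemma lower_span_raise c v i : lower_span c v ->
  (c i = 0%N -> r (xp (A i)) v = 0) /\
  ((0 < c i)%N -> lower_span (fun j => c j - simple_index i j)%N (r (xp (A i)) v)).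
Proof.
elim=> {c v} [|c j v cv [IH0 IHS]|c|c k u v _ [IHu0 IHuS] _ [IHv0 IHvS]]; split=> //.
- move=> ci; rewrite (actionC actr).
  have ij : i != j by apply: contraPneq ci => ->; rewrite /simple_index eqxx.
  rewrite simple_root_brackets // action0 // addr0 IH0 ?linear0 //.
  by move: ci; rewrite /simple_index (negPf ij).
- move=> ci; rewrite (actionC actr); apply: lower_spanD.
    have [ci0|ci0] := posnP (c i); first by rewrite IH0 // linear0; apply: LowerZero.
    have := LowerStep j (IHS ci0); congr lower_span; apply/funext => k.
    by rewrite /simple_index; case: (k =P i) => [->|_]; lia.
  have [<-|ij] := eqVneq i j; last first.
    by rewrite simple_root_brackets // action0 //; apply: LowerZero.
  have [_ _ _ ->] := rvec (positive_simple i).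
  rewrite (lower_span_weight _ cv); apply: lower_spanZ.
  by move: cv; congr lower_span; apply/funext => k; rewrite addKn.
- by rewrite linear0.
- by rewrite linear0 => _; apply: LowerZero.
- by move=> ci; rewrite linearP /= IHu0 // IHv0 // scaler0 addr0.
by move=> ci; rewrite linearP /=; apply: LowerLin; [apply: IHuS | apply: IHvS].
Qed.

Lemma lower_span_iter_lower c v i k : lower_span c v ->
  lower_span (fun j => k * simple_index i j + c j)%N (iter k (r (xm (A i))) v).
Proof.
move=> cv; elim: k => [|k IH] //=.
by have := LowerStep i IH; congr lower_span; apply/funext => j; rewrite mulSn addnA.
Qed.

Lemma lower_span_iter_raise c v i k : lower_span c v ->
  iter k (r (xp (A i))) v != 0 -> (k <= c i)%N /\
  lower_span (fun j => c j - k * simple_index i j)%N (iter k (r (xp (A i))) v).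
Proof.
move=> cv; elim: k => [|k IH] /= ek0.
  by split=> //; move: cv; congr lower_span; apply/funext => j; rewrite subn0.
have [|kc /(lower_span_raise i)[e0 eS]] := IH.
  by apply: contraNneq ek0 => ->; rewrite linear0.
have ltkc : (k < c i)%N.
  rewrite ltn_neqAle kc andbT; apply: contraNneq ek0 => kE; rewrite e0 //.
  by rewrite /simple_index eqxx kE muln1 subnn.
split=> //; have := eS; rewrite {1}/simple_index eqxx muln1 subn_gt0 => /(_ ltkc).
by congr lower_span; apply/funext => j; rewrite mulSnr subnDA.
Qed.

Lemma simple_vec_ad_nilpotent s i j :
  nilpotent_at (ad (simple_vec s i)) (simple_vec true j).
Proof.
have sl2 := coroot_sl2 (positive_simple i); case: sl2 => _ he hf.
have [[_ _ _ ay] _ _ _] := rvec (positive_simple j).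
have d0 : (-1) ^+ s * 2 != 0 :> K by rewrite mulf_neq0 ?signr_eq0 ?pnatr_eq0.
apply: (@shift_nilpotent _ L (ad (vsval (hc (A i)))) _ _ _ _ d0 _ (ay _)) => u.
by case: s {d0}; rewrite ?mulN1r ?scaleNr ?mul1r; [exact: hf | exact: he].
Qed.

Lemma nilpotent_at_lin (g : {linear V -> V}) (k : K) u v :
  nilpotent_at g u -> nilpotent_at g v -> nilpotent_at g (k *: u + v).
Proof.
case=> a gu [b gv]; exists (a + b)%N.
have iterP m : iter m g (k *: u + v) = k *: iter m g u + iter m g v.
  by elim: m => //= m ->; rewrite linearP.
rewrite iterP [in X in _ *: X]addnC !iterD gu gv.
by rewrite !(iter_fix _ (linear0 g)) scaler0 addr0.
Qed.

(** [V] may be infinite-dimensional, so nilpotence starts from the relations on [w] and spreads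
    along lowering operators by [nilpotent_at_action]. *)
Lemma lower_span_nilpotent c v s i : lower_span c v ->
  nilpotent_at (r (simple_vec s i)) v.
Proof.
elim=> {c v} [|c j v _ IH|c|c k u v _ IHu _ IHv].
- case: s; last by exists 1%N; apply: w_raise.
  by have [m _ fw] := w_lower i; exists m.+1.
- exact: (nilpotent_at_action actr (simple_vec_ad_nilpotent s i j) IH).
- by exists 0%N.
exact: nilpotent_at_lin.
Qed.

(* (la, la) - (mu, mu) for mu = la - nat_comb c. *)
Definition coroot_sum c : subvs_of H :=
  \sum_i ((c i)%:R / root_norm (A i)) *: hc (A i).

Lemma simple_coroot_sum i c :
  A i @@ coroot_sum c = (nat_comb c @@ hc (A i)) / root_norm (A i).
Proof.
have nz j : root_norm (A j) != 0.
  by rewrite gt_eqF // root_norm_gt0 //; exact: positive_simple.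
rewrite linear_sum nat_combE mulr_suml; apply: eq_bigr => j _.
rewrite linearZ /= -[LHS]/(_ * _ * _) -!mulrA; congr (_ * _); apply: (mulfI (nz j)).
rewrite mulVKf // mulrA.
rewrite -(coroot_symmetry (positive_simple i) (positive_simple j)).
by rewrite mulrC mulKf.
Qed.

(** This is [(2 la - g, g)] for [g = nat_comb c], since [coroot_sum c] represents [g] in the Killing
    form. *)
Definition norm_drop c : K :=
  (2 *: la - nat_comb c) @@ coroot_sum c.

Lemma norm_dropE c : norm_drop c = \sum_i ((c i)%:R / root_norm (A i)) *
  (la @@ hc (A i) + (la - nat_comb c) @@ hc (A i)).
Proof.
rewrite /norm_drop linear_sum; apply: eq_bigr => i _; rewrite linearZ /=.
congr (_ * _); rewrite !add_lfunE scale_lfunE opp_lfunE.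
by rewrite addrA -mulr2n; congr (_ - _); exact: mulr_natl.
Qed.

(** The reflection in [A i] exchanges [la - nat_comb c] and [la - nat_comb c'] and preserves the
    norm. *)
Lemma norm_drop_reflect c c' i (m : nat) :
  c = (fun j => m * simple_index i j + c' j)%N ->
  (la - nat_comb c) @@ hc (A i) = - m%:R -> norm_drop c = norm_drop c'.
Proof.
move=> cE; have ncE : nat_comb c = m%:R *: A i + nat_comb c'.
  rewrite cE nat_combD; congr (_ + _); rewrite -nat_comb_simple scaler_sumr.
  by apply: eq_bigr => j _; rewrite natrM scalerA.
have gE : coroot_sum c = (m%:R / root_norm (A i)) *: hc (A i) + coroot_sum c'.
  rewrite /coroot_sum cE.
  under eq_bigr do rewrite natrD mulrDl scalerDl.
  rewrite big_split; congr (_ + _); rewrite (bigD1 i) //= /simple_index eqxx.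
  by rewrite muln1 big1 ?addr0 // => j /negPf->; rewrite muln0 mul0r scale0r.
have comb (p : K) h : (p *: la - nat_comb c) @@ h =
    p * (la @@ h) - (m%:R * (A i @@ h) + nat_comb c' @@ h).
  by rewrite ncE add_lfunE opp_lfunE add_lfunE !scale_lfunE.
rewrite -[la in LHS]scale1r comb => muE.
rewrite /norm_drop gE linearP /= -[X in X + _]/(_ * _) !comb simple_coroot_sum.
rewrite add_lfunE opp_lfunE scale_lfunE -[X in _ = X - _]/(_ * _).
move: muE; rewrite (coroot_pairing (positive_simple i)).
have := root_norm_gt0 (positive_simple i); move: (root_norm _) => b b0.
set x := la @@ hc (A i); set y := nat_comb c' @@ hc (A i).
move=> /eqP; rewrite -subr_eq0 => /eqP xy.
have -> : x = y + m%:R by apply/eqP; rewrite -subr_eq0 -xy; apply/eqP; ring.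
by field; rewrite gt_eqF.
Qed.

(* Reflecting in A i a weight that is negative on hc (A i) gives a higher weight
   of the same norm; a weight mu below la that is dominant satisfies
   (la, la) - (mu, mu) = (la + mu, la - mu) >= 0. *)
Lemma norm_drop_ge0 c v : lower_span c v -> v != 0 -> 0 <= norm_drop c.
Proof.
have [k] := ubnP (\sum_i c i)%N; elim: k => // k IH in c v * => ck cv v0.
have [dom|/existsNP[i /negP aneg]] :=
    pselect (forall i, 0 <= (la - nat_comb c) @@ hc (A i)).
  rewrite norm_dropE; apply: sumr_ge0 => i _; apply: mulr_ge0.
    by rewrite divr_ge0 ?ler0n // ltW // root_norm_gt0 //; exact: positive_simple.
  by rewrite addr_ge0 ?dom //; have [p -> _] := w_lower i; rewrite ler0n.
have [_ hx hy xy] := rvec (positive_simple i).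
(* The triple is reversed, so that the weight of [v] to be reflected becomes the positive one. *)
have sl2 := sl2_opp (sl2_action actr xy hx hy).
have nil s c' v' : lower_span c' v' -> nilpotent_at (r (simple_vec s i)) v'.
  exact: lower_span_nilpotent.
have hv : (\- r (vsval (hc (A i)))) v = - ((la - nat_comb c) @@ hc (A i)) *: v.
  by rewrite /= (lower_span_weight _ cv) scaleNr.
have nilf := nil true _ _ cv.
have nile l : nilpotent_at (r (xp (A i))) (iter l (r (xm (A i))) v).
  exact: (nil false _ _ (lower_span_iter_lower i l cv)).
(* The order on [K] is partial, so failure of [0 <= x] gives no sign by itself; integrality from the
   string does. *)
have [m muE] : exists m : nat, (la - nat_comb c) @@ hc (A i) = - m%:R.
  have [p [q [/eqP]]] := sl2_weight_string sl2 v0 hv nilf nile.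
  rewrite eqr_oppLR => /eqP muE _; exists (q - 2 * p)%N.
  rewrite muE -natrM natrB //; rewrite leqNgt; apply: contra aneg => ltqp.
  by rewrite muE opprB -natrM subr_ge0 ler_nat ltnW.
have m0 : (0 < m)%N.
  by rewrite lt0n; apply: contra aneg => /eqP m0; rewrite muE m0 oppr0.
(* Lowering [l] times and raising [l + m] times leads to the reflected weight, of smaller height
   below [la]. *)
have [|l el0] := sl2_reflect sl2 v0 _ nilf nile (m := m).
  by apply: etrans hv _; rewrite muE opprK.
have [lc ev] := lower_span_iter_raise (lower_span_iter_lower i l cv) el0.
pose c' := (fun j => c j - m * simple_index i j)%N.
have mc : (m <= c i)%N by move: lc; rewrite /simple_index eqxx; lia.
have cE : c = (fun j => m * simple_index i j + c' j)%N.
  apply/funext => j; rewrite /c' /simple_index; case: (j =P i) => [->|_]; lia.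
rewrite (norm_drop_reflect cE muE).
apply: (IH _ (iter (l + m) (r (xp (A i))) (iter l (r (xm (A i))) v))) => //.
  move: ck; rewrite ltnS; apply: leq_trans.
  rewrite [in X in (_ < X)%N]cE big_split -[X in (X < _)%N]add0n ltn_add2r.
  by rewrite (bigD1 i) //= /simple_index eqxx; lia.
move: ev; congr lower_span; apply/funext => j; rewrite /c'; lia.
Qed.

(** The vector has weight [la - (N + 1) a], where [norm_drop] is a positive multiple of
    [2 * N - 2 * (N + 1)], against [norm_drop_ge0] unless the vector is 0. *)
Lemma lowering_power_eq0 a (N : nat) : positive_root D a -> la @@ hc a = N%:R ->
  iter N.+1 (r (xm a)) w = 0.
Proof.
move=> posa laN; have [_ [c aE]] := posa.
have xma c' v : lower_span c' v ->
    lower_span (fun j => c j + c' j)%N (r (xm a) v).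
  have [[_ _ _ ay] _ _ _] := rvec posa; move: c' v.
  apply: (@positive_root_ind true (fun c x => forall c' v, lower_span c' v ->
    lower_span (fun j => c j + c' j)%N (r x v))) => [i k c' v cv|c1 i z IH c' v cv||].
  - by rewrite actionZ //; apply/lower_spanZ/LowerStep.
  - rewrite action_lie // -scaleN1r addrC; apply: LowerLin.
      have := IH _ _ (LowerStep i cv); congr lower_span; apply/funext => j; lia.
    have := LowerStep i (IH _ _ cv); congr lower_span; apply/funext => j; lia.
  - by rewrite /nat_comb -aE.
  by rewrite scaleN1r /nat_comb -aE.
have kw k : lower_span (fun j => k * c j)%N (iter k (r (xm a)) w).
  elim: k => [|k /xma /=]; first exact: LowerGen.
  by congr lower_span; apply/funext => j; rewrite mulSn.
apply/eqP/negPn/negP => /(norm_drop_ge0 (kw _)); apply/negP.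
set k := N.+1; set kc := (fun j => k * c j)%N.
have ncE : nat_comb kc = k%:R *: a.
  rewrite aE scaler_sumr; apply: eq_bigr => j _.
  by rewrite natrM scalerA.
have ha : hc a = root_norm a *: coroot_sum c.
  by rewrite aE; apply: coroot_comb; rewrite /nat_comb -aE.
have b0 := root_norm_gt0 posa.
have gE : coroot_sum kc = (k%:R / root_norm a) *: hc a.
  rewrite ha scalerA divfK ?gt_eqF // scaler_sumr; apply: eq_bigr => j _.
  by rewrite natrM -mulrA scalerA.
rewrite /norm_drop gE linearZ /= ncE add_lfunE opp_lfunE !scale_lfunE.
rewrite laN (coroot_pairing posa).
apply/negbT/lt_geF; change (k%:R / root_norm a * (2 * N%:R - k%:R * 2) < 0).
rewrite pmulr_rlt0 ?divr_gt0 ?ltr0n //.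
by rewrite subr_lt0 mulrC ltr_pM2r ?ltr0n // ltr_nat.
Qed.

End Integrability.

End RootSystem.

(** * Garland's identity *)

Section Convolution.
Variables (K : fieldType) (V : lmodType K).
Implicit Types (a b d : nat -> {linear V -> V}) (v : nat -> V) (s : nat).

(** The coefficient of u^s in the product of the series [\sum_p a_p u^p] and [\sum_q v_q u^q]. *)
Definition conv a v s : V := \sum_(p < s.+1) a p (v (s - p)%N).

Lemma eq_conv a v v' : v =1 v' -> conv a v =1 conv a v'.
Proof. by move=> vv' s; apply: eq_bigr => p _; rewrite vv'. Qed.

Lemma convZ a v (k : K) s : conv a (fun j => k *: v j) s = k *: conv a v s.
Proof. by rewrite scaler_sumr; apply: eq_bigr => p _; rewrite linearZ. Qed.

(** The commutator of the two series is [\sum_m (m + 1) d_m u^m], because [m + 1] pairs [(p, q)]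
    have [p + q = m]. *)
Lemma conv_comm a b d v s :
  (forall p q u, a p (b q u) = b q (a p u) + d (p + q)%N u) ->
  conv a (conv b v) s = conv b (conv a v) s
    + \sum_(m < s.+1) m.+1%:R *: d m (v (s - m)%N).
Proof.
move=> abd.
(* Triangular sums are written over the full square so that their order can be exchanged. *)
have triE (F : nat -> nat -> V) : \sum_(p < s.+1) \sum_(q < (s - p).+1) F p q =
    \sum_(p < s.+1) \sum_(q < s.+1) if (p + q <= s)%N then F p q else 0.
  apply: eq_bigr => p _; rewrite -big_mkcond /=.
  have ps : ((s - p).+1 <= s.+1)%N by rewrite ltnS leq_subr.
  rewrite (big_ord_widen _ (F p) ps); apply: eq_bigl => q.
  by rewrite ltnS leq_subRL // -ltnS.
have -> : conv a (conv b v) s = \sum_(p < s.+1) \sum_(q < (s - p).+1)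
    (b q (a p (v (s - p - q)%N)) + d (p + q)%N (v (s - p - q)%N)).
  by apply: eq_bigr => p _; rewrite linear_sum; apply: eq_bigr.
rewrite (triE (fun p q => b q (a p (v (s - p - q)%N)) + d (p + q)%N (v (s - p - q)%N))).
have -> : conv b (conv a v) s = \sum_(q < s.+1) \sum_(p < (s - q).+1)
    b q (a p (v (s - q - p)%N)).
  by apply: eq_bigr => p _; rewrite linear_sum.
rewrite (triE (fun q p => b q (a p (v (s - q - p)%N)))) [X in X + _]exchange_big /=.
have -> : \sum_(m < s.+1) m.+1%:R *: d m (v (s - m)%N) =
    \sum_(p < s.+1) \sum_(m < s.+1 | (p <= m)%N) d m (v (s - m)%N).
  rewrite (exchange_big_dep predT) //=; apply: eq_bigr => m _.
  rewrite sumr_const scaler_nat; congr (_ *+ _).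
  transitivity (\sum_(p < m.+1) 1)%N; first by rewrite sum_nat_const card_ord muln1.
  rewrite (big_ord_widen _ (fun => 1%N) (ltn_ord m)).
  by rewrite sum1_card.
rewrite -big_split; apply: eq_bigr => p _ /=.
have -> : \sum_(m < s.+1 | (p <= m)%N) d m (v (s - m)%N) =
    \sum_(q < s.+1) if (p + q <= s)%N then d (p + q)%N (v (s - p - q)%N) else 0.
  rewrite -!big_mkcond /= -(big_mkord (fun m => p <= m)%N (fun m => d m (v (s - m)%N))).
  rewrite -(big_mkord (fun q => p + q <= s)%N (fun q => d (p + q)%N (v (s - p - q)%N))).
  rewrite (big_cat_nat (leq0n p) (ltnW (ltn_ord p))) /= big_nat_cond.
  rewrite big_pred0 ?add0r; last first.
    by move=> m; apply/negP; lia.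
  rewrite -{1}[nat_of_ord p]add0n big_addn.
  have sp : (s.+1 - p <= s.+1)%N by rewrite leq_subr.
  rewrite [RHS](big_cat_nat (leq0n _) sp) /= [X in _ = _ + X]big_nat_cond.
  rewrite [X in _ = _ + X]big_pred0 ?addr0; last by move=> q; apply/negP; lia.
  rewrite big_nat_cond [RHS]big_nat_cond.
  apply: eq_big => [q|q _]; first lia.
  by rewrite addnC subnDA.
rewrite -big_split; apply: eq_bigr => q _ /=.
rewrite addnC -(subnDA q) addnC subnDA.
by case: ifP => _; rewrite ?addr0.
Qed.

End Convolution.

Section Garland.
Variables (K : numFieldType) (V : lmodType K).
Variables (f h : nat -> {linear V -> V}) (e : {linear V -> V}) (w : V).
Hypothesis fC : forall p q v, f p (f q v) = f q (f p v).
Hypothesis ef : forall p v, e (f p v) = f p (e v) + h p.+1 v.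
Hypothesis hf : forall p q v, h p (f q v) = f q (h p v) - 2 *: f (p + q)%N v.
Hypothesis ew : e w = 0.
Hypothesis hw : forall p, h p.+1 w = 0.

(* The coefficient of u^s in (\sum_p f_p u^p)^r w, that is, r! x^-(r, s) w. *)
Fixpoint power_coef (r s : nat) : V :=
  if r is r'.+1 then \sum_(p < s.+1) f p (power_coef r' (s - p)%N)
  else if s is 0 then w else 0.

Local Notation Y := power_coef.

(** The coefficients of the derivative f'(u) of [f(u) = \sum_p f_p u^p]. *)
Definition deriv_op (m : nat) : V -> V := fun v => m.+1%:R *: f m.+1 v.

Fact deriv_op_is_linear m : linear (deriv_op m).
Proof.
by move=> k u v; rewrite /deriv_op linearP /= scalerDr !scalerA mulrC.
Qed.

HB.instance Definition _ m :=
  GRing.isLinear.Build K V V _ (deriv_op m) (deriv_op_is_linear m).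

Local Notation f' := (fun m => deriv_op m : {linear V -> V}).
Local Notation h' := (fun m => h m.+1).

Lemma power_coefS r s : Y r.+1 s = conv f (Y r) s.
Proof. by []. Qed.

Lemma conv_f_deriv v s : conv f (conv f' v) s = conv f' (conv f v) s.
Proof.
have zlin : linear (fun _ : V => 0 : V) by move=> k u u'; rewrite scaler0 addr0.
pose z : {linear V -> V} := HB.pack (fun _ : V => 0 : V)
  (GRing.isLinear.Build K V V _ _ zlin).
rewrite (@conv_comm _ _ f f' (fun _ => z)) => [|p q u].
  by rewrite big1 ?addr0 // => m _; rewrite scaler0.
by rewrite addr0 /= /deriv_op linearZ /= fC.
Qed.

(** With [h'(u) = \sum_m h_(m+1) u^m], the hypothesis [hf] gives [[h'(u), f(u)] = -2 f'(u)]; now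
    move [h'(u)] through the [r] factors [f(u)] to [w], which it kills. *)
Lemma conv_h_power r s : conv h' (Y r) s = - (2 * r%:R) *: conv f' (Y r.-1) s.
Proof.
elim: r s => [|r IH] s.
  rewrite mulr0 oppr0 scale0r /conv big1 // => -[p] /= _ _.
  by case: (s - p)%N => [|j]; rewrite ?hw ?linear0.
pose d m : V -> V := fun u => - 2 *: f m.+1 u.
have dlin m : linear (d m).
  by move=> k u v; rewrite /d linearP /= scalerDr !scalerA mulrC.
pose dd m : {linear V -> V} := HB.pack (d m) (GRing.isLinear.Build K V V _ _ (dlin m)).
have -> : conv h' (Y r.+1) s = conv h' (conv f (Y r)) s by [].
rewrite (@conv_comm _ _ h' f dd) => [|p q u]; last first.
  by rewrite hf addSn /= /d scaleNr.
rewrite (eq_conv _ IH) convZ.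
have -> : \sum_(m < s.+1) m.+1%:R *: dd m (Y r (s - m)%N) = - 2 *: conv f' (Y r) s.
  by rewrite scaler_sumr; apply: eq_bigr => m _; rewrite /= /d /deriv_op !scalerA mulrC.
case: r IH => [|r] IH; first by rewrite mulr0 oppr0 scale0r add0r mulr1.
rewrite conv_f_deriv -[conv f' _ s]/(conv f' (Y r.+1) s) -scalerDl.
by congr (_ *: _); rewrite -[r.+2%:R]natr1; ring.
Qed.

(** Since [[e, f(u)] = h'(u)] and [e w = 0], the terms given by [conv_h_power] add up. For [r <= 1]
    the truncated index is harmless, the scalar being 0. *)
Lemma e_power_coef_deriv r s :
  e (Y r s) = - (r%:R * (r%:R - 1)) *: conv f' (Y r.-2) s.
Proof.
elim: r s => [|r IH] s.
  by rewrite mul0r oppr0 scale0r; case: s => [|s] //=; rewrite linear0.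
rewrite power_coefS linear_sum.
under eq_bigr do rewrite ef; rewrite big_split /= -[X in _ + X]/(conv h' (Y r) s).
rewrite -[X in X + _]/(conv f (fun j => e (Y r j)) s) (eq_conv _ IH) convZ.
rewrite conv_h_power conv_f_deriv; case: r IH => [|[|r]] IH.
- by rewrite !mul0r mulr0 !oppr0 !scale0r addr0 subrr mulr0 oppr0 scale0r.
- rewrite subrr mulr0 oppr0 scale0r add0r; congr (_ *: _).
  by rewrite -[2%:R]natr1; ring.
rewrite -[conv f' (conv f _) s]/(conv f' (Y r.+1) s) -scalerDl.
by congr (_ *: _); rewrite -[r.+3%:R]natr1; ring.
Qed.

(** The coefficient of u^s in [(f^(r+1))' = (r + 1) f' f^r]. *)
Lemma power_coef_deriv r s :
  s.+1%:R *: Y r.+1 s.+1 = r.+1%:R *: conv f' (Y r) s.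
Proof.
elim: r s => [|r IH] s.
  rewrite scale1r /= (bigD1 ord_max) //= subnn big1 ?addr0 => [|p pmax].
    rewrite /conv (bigD1 ord_max) //= subnn big1 ?addr0 // => p pmax.
    by case E : (s - p)%N => [|j]; rewrite ?linear0 //; case/eqP: pmax;
      apply: val_inj => /=; have := ltn_ord p; lia.
  by case E : (s.+1 - p)%N => [|j]; rewrite ?linear0 //; case/eqP: pmax;
    apply: val_inj => /=; have := ltn_ord p; lia.
rewrite power_coefS scaler_sumr.
have -> : \sum_(p < s.+2) s.+1%:R *: f p (Y r.+1 (s.+1 - p)%N) =
    \sum_(p < s.+2) p%:R *: f p (Y r.+1 (s.+1 - p)%N) +
    \sum_(p < s.+2) (s.+1 - p)%:R *: f p (Y r.+1 (s.+1 - p)%N).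
  rewrite -big_split; apply: eq_bigr => p _ /=.
  by rewrite -scalerDl -natrD subnKC // -ltnS.
rewrite big_ord_recl scale0r add0r -[X in X + _]/(conv f' (Y r.+1) s).
rewrite big_ord_recr /= subnn scale0r addr0.
have -> : \sum_(p < s.+1) (s.+1 - p)%:R *: f p (Y r.+1 (s.+1 - p)%N) =
    r.+1%:R *: conv f (conv f' (Y r)) s.
  rewrite scaler_sumr; apply: eq_bigr => p _.
  by rewrite subSn -1?ltnS // -!linearZ IH.
rewrite conv_f_deriv -[conv f' (conv f _) s]/(conv f' (Y r.+1) s).
by rewrite -{1}[conv f' _ s]scale1r -scalerDl nat1r.
Qed.

(** By the two preceding identities [e f(u)^(r+1) w] is [- (r + 1)] times the derivative of
    [f(u)^r w]: [e] trades one factor for one degree in u. *)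
Lemma e_power_coef r s :
  e (Y r.+1 s) = - (r.+1%:R * s.+1%:R) *: Y r s.+1.
Proof.
rewrite e_power_coef_deriv; case: r => [|r].
  by rewrite subrr mulr0 oppr0 scale0r scaler0.
rewrite -[in RHS]mulNr -[RHS]scalerA power_coef_deriv scalerA.
by congr (_ *: _); rewrite -[r.+2%:R]natr1; ring.
Qed.

(** Start from [f_0^(s+r) w], with [s + r] factors and degree 0; each of the [s] operators [e]
    trades a factor for a degree, with a non-zero scalar. *)
Lemma garland r s :
  exists2 c : K, c != 0 & iter s e (iter (s + r) (f 0%N) w) = c *: Y r s.
Proof.
have -> : iter (s + r) (f 0%N) w = Y (s + r) 0.
  by elim: (s + r)%N => //= m ->; rewrite big_ord1.
suff gen j : exists2 c : K, c != 0 & iter s e (Y (s + r) j) = c *: Y r (s + j)%N.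
  by have := gen 0%N; rewrite addn0.
elim: s j => [|s IH] j; first by exists 1; rewrite ?oner_eq0 ?scale1r.
have [c c0 cE] := IH j.+1.
exists (- ((s + r).+1%:R * j.+1%:R) * c).
  by rewrite mulf_neq0 // oppr_eq0 mulf_neq0 // pnatr_eq0.
have iterZ m k v : iter m e (k *: v) = k *: iter m e v.
  by elim: m => //= m ->; rewrite linearZ.
by rewrite iterSr addSn e_power_coef iterZ cE scalerA addnS.
Qed.

(** * Vanishing criteria and the two sets of relations for one root *)

Lemma power_coef_eq0 p r s : f p w = 0 -> f p (Y r s) = 0.
Proof.
move=> fp0; elim: r s => [|r IH] s; first by case: s => [|s]; rewrite ?linear0.
by rewrite linear_sum big1 // => q _; rewrite fC IH linear0.
Qed.

Lemma power_coef_vanish m r s : (forall p, (m < p)%N -> f p w = 0) ->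
  (r * m < s)%N -> Y r s = 0.
Proof.
move=> fm; elim: r s => [|r IH] s rms; first by case: s rms.
rewrite /= big1 // => p _; have [pm|mp] := leqP p m.
  by rewrite IH ?linear0 //; lia.
exact/power_coef_eq0/fm.
Qed.

(** If [r] indices are at most [m] and have sum [r * m], they all equal [m]. *)
Lemma power_coef_top m r : (forall p, (m < p)%N -> f p w = 0) ->
  Y r (r * m) = iter r (f m) w.
Proof.
move=> fm; elim: r => [|r IH] //.
have mP : (m < (r.+1 * m).+1)%N by rewrite ltnS mulSn leq_addr.
rewrite /= (bigD1 (Ordinal mP)) //= [(_ - m)%N](_ : _ = r * m)%N ?mulSn ?addKn //.
rewrite IH big1 ?addr0 // => p pm.
have [ltpm|ltmp|pmE] := ltngtP p m.
- by rewrite (power_coef_vanish fm) ?linear0 //; lia.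
- exact/power_coef_eq0/fm.
by case/eqP: pm; apply: val_inj.
Qed.

Lemma power_coef1 s : Y 1 s = f s w.
Proof.
rewrite /= big_ord_recr /= subnn big1 ?add0r // => p _.
by case E : (s - p)%N => [|j]; rewrite ?linear0 //; have := ltn_ord p; lia.
Qed.

(* In each monomial f_{p_1} ... f_{p_r} w with sum of the p_i equal to s, the
   index m + 1 must occur at least s - r m times, since no index exceeds it. *)
Lemma power_coef_vanish_hook m k r s j :
  (forall p, (m.+1 < p)%N -> f p w = 0) -> iter k (f m.+1) w = 0 ->
  (r * m + k <= s + j)%N -> iter j (f m.+1) (Y r s) = 0.
Proof.
move=> fm fk; have iter0 i : iter i (f m.+1) 0 = 0 by apply/iter_fix/linear0.
elim: r s j => [|r IH] s j ks.
  case: s ks => [|s] //= ks; have -> : j = ((j - k) + k)%N by lia.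
  by rewrite iterD fk.
have iterC i p v : iter i (f m.+1) (f p v) = f p (iter i (f m.+1) v).
  by elim: i => //= i ->; rewrite fC.
have -> : iter j (f m.+1) (Y r.+1 s) =
    \sum_(p < s.+1) iter j (f m.+1) (f p (Y r (s - p)%N)).
  rewrite power_coefS /conv; elim: j {ks} => //= j ->.
  by rewrite linear_sum.
rewrite big1 // => p _; rewrite iterC.
(* An index [p <= m] uses up at most [m] of the degree, one above [m + 1] kills the term, and
   [p = m + 1] joins the [j] factors collected in front. *)
have [ltpm|ltmp|pE] := ltngtP p m.+1.
- by rewrite IH ?linear0 //; have := ltn_ord p; lia.
- by rewrite -iterC power_coef_eq0 // fm.
have := ltn_ord p; rewrite pE -iterS => ltms; rewrite IH //; lia.
Qed.

(** If [f_p w = 0], then [0 = h_1 f_p w = -2 f_(p+1) w]. *)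
Lemma lowering_eq0 m p : f m w = 0 -> (m <= p)%N -> f p w = 0.
Proof.
move=> fm /subnKC <-; elim: (p - m)%N => [|j IH]; first by rewrite addn0.
have := hf 1 (m + j) w; rewrite IH hw !linear0 sub0r add1n addnS => /esym/eqP.
by rewrite oppr_eq0 scaler_eq0 pnatr_eq0 => /eqP.
Qed.

Lemma power_coef_weyl N r s :
  iter N.+1 (f 0%N) w = 0 -> (N < s + r)%N -> Y r s = 0.
Proof.
move=> fN ltN; have [c c0 cE] := garland r s.
apply/eqP; rewrite -[_ == 0]orFb -(negPf c0) -scaler_eq0 -cE.
rewrite -(subnK ltN) iterD fN !(iter_fix _ (linear0 _)) //.
Qed.

(** The relations of V(xi) at one root, with [e^s f_0^(s+r) w] replaced by [Y r s] through Garland's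
    identity. *)
Definition fusion_vanishing (xi : seq nat) : Prop := forall s r k,
  (0 < s)%N -> (0 < r)%N -> (0 < k)%N ->
  (1 + r * k + sumn (drop k xi) <= s + r)%N -> Y r s = 0.

Definition reduced_vanishing (xi : seq nat) : Prop :=
  f (size xi) w = 0 /\ (special_fat_hook xi ->
    iter (nth 0%N xi (size xi).-1).+1 (f (size xi).-1) w = 0).

Lemma reduced_fusion_vanishing xi : rectangular xi \/ special_fat_hook xi ->
  iter (sumn xi).+1 (f 0%N) w = 0 ->
  reduced_vanishing xi -> fusion_vanishing xi.
Proof.
move=> shape weyl [top hook] s r k s0 r0 k0.
have vanish m : (size xi <= m.+1)%N -> (r * m < s)%N -> Y r s = 0.
  move=> xim; apply: power_coef_vanish => p mp.
  exact: lowering_eq0 top (leq_trans xim mp).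
case: shape => [rect|hk].
  have [m [k1 xiE]] : exists m k1, xi = nseq m k1.
    case: rect => [->|[k1 [m [_ _ ->]]]]; first by exists 0%N, 0%N.
    by exists m, k1.
  move: weyl vanish; rewrite xiE drop_nseq !sumn_nseq size_nseq => weyl vanish ge.
  (* For [k >= m] the tail is empty and [s > r * (k - 1)]; for [r >= k1] the bound gives
     [s + r > m * k1]; otherwise [r < k1] gives [s > r * (m - 1)]. *)
  have [mk|km] := leqP m k.
    by case: k k0 ge mk => //= k _ ge mk; apply: (vanish k); nia.
  have [k1r|rk1] := leqP k1 r; first by apply: (power_coef_weyl weyl); nia.
  by case: m vanish km ge {weyl xiE} => //= m vanish km ge; apply: (vanish m); nia.
have := hk; move=> [k1 [[|m] [k2 []]]] // _ _ _ _ xiE ge.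
have szE : size xi = m.+2 by rewrite xiE size_cat !size_nseq addn1.
have fhook : iter k2.+1 (f m.+1) w = 0.
  have := hook hk; rewrite szE xiE nth_cat size_nseq ltnn subnn.
  by [].
(* The same three ranges for [m + 1] parts [k1] and one part [k2]. In the last one the bound gives
   only [s >= r * m + k2 + 1], and the hook relation enters. *)
have [mk|km] := leqP m.+2 k.
  by apply: (vanish m.+1); rewrite ?szE //; nia.
have sumE : sumn (drop k xi) = ((m.+1 - k) * k1 + k2)%N.
  rewrite xiE drop_cat size_nseq; case: ltngtP => // [ltkm|ltmk|->].
  - by rewrite drop_nseq sumn_cat sumn_nseq /= addn0 mulnC.
  - by lia.
  by rewrite !subnn /= addn0 mul0n.
have totE : sumn xi = (m.+1 * k1 + k2)%N.
  by rewrite xiE sumn_cat !sumn_nseq mulnC muln1.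
have [k1r|rk1] := leqP k1 r.
  by apply: (power_coef_weyl weyl); rewrite totE; nia.
apply: (power_coef_vanish_hook (m := m) (k := k2.+1) (j := 0)) => //; last by nia.
by move=> p mp; apply: lowering_eq0 top _; rewrite szE.
Qed.

Lemma fusion_reduced_vanishing xi :
  iter (sumn xi).+1 (f 0%N) w = 0 ->
  fusion_vanishing xi -> reduced_vanishing xi.
Proof.
move=> weyl fus; have top : f (size xi) w = 0.
  (* The empty partition would need [s = 0], which [fusion_vanishing] excludes; there [f_0 w = 0] is
     the Weyl relation itself. *)
  case E : (size xi) => [|m].
    by move: weyl; rewrite (size0nil E).
  (* Here [r = 1] and [s = k = size xi]. *)
  rewrite -power_coef1; apply: (fus _ _ (size xi)); rewrite ?E //.
  by rewrite -E drop_size mul1n addn0 add1n addn1.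
split=> // -[k1 [[|m] [k2 []]]] // _ _ _ _ xiE.
have szE : size xi = m.+2 by rewrite xiE size_cat !size_nseq addn1.
rewrite szE {1}xiE nth_cat size_nseq ltnn subnn.
rewrite -power_coef_top; last first.
  by move=> p mp; apply: lowering_eq0 top _; rewrite szE.
(* Here [r = k2 + 1], [k = m + 1] and [s = r * k] meet the bound with equality. *)
apply: (fus _ _ m.+1) => //.
rewrite xiE drop_cat size_nseq ltnn subnn /= addn0; nia.
Qed.

End Garland.

(** * Restriction of scalars *)

(** A separate name for the type lets it carry a [K]-linear structure beside the [A]-module
    structure. *)
Definition restrict_scalars (K : fieldType) (A : algType K) (V : lmodType A) : Type :=
  V.

Section RestrictScalars.
Variables (K : fieldType) (A : algType K) (V : lmodType A).
Local Notation VK := (restrict_scalars V).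

HB.instance Definition _ := GRing.Zmodule.on VK.

Definition restrict_scale (k : K) (v : VK) : VK := (k%:A : A) *: (v : V).

Fact restrict_scaleA a b v :
  restrict_scale a (restrict_scale b v) = restrict_scale (a * b) v.
Proof. by rewrite /restrict_scale scalerA -scalerAl mul1r scalerA. Qed.

Fact restrict_scale1 : left_id 1 restrict_scale.
Proof. by move=> v; rewrite /restrict_scale !scale1r. Qed.

Fact restrict_scaleDr : right_distributive restrict_scale +%R.
Proof. by move=> a u v; rewrite /restrict_scale scalerDr. Qed.

Fact restrict_scaleDl v : {morph restrict_scale^~ v : a b / a + b}.
Proof. by move=> a b; rewrite /restrict_scale !scalerDl. Qed.

HB.instance Definition _ := GRing.Zmodule_isLmodule.Build K VK
  restrict_scaleA restrict_scale1 restrict_scaleDr restrict_scaleDl.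

Definition module_act (a : A) (v : VK) : VK := a *: (v : V).

Fact module_act_is_linear a : linear (module_act a).
Proof.
move=> k u v; rewrite /module_act scalerDr; congr (_ + _).
rewrite -[k *: u]/((k%:A : A) *: (u : V)) -[RHS]/((k%:A : A) *: (a *: (u : V))).
by rewrite !scalerA -scalerAl mul1r -scalerAr mulr1.
Qed.

HB.instance Definition _ a :=
  GRing.isLinear.Build K VK VK _ (module_act a) (module_act_is_linear a).

Lemma module_act_linearl v : linear (module_act^~ v).
Proof.
move=> k a b; rewrite /module_act scalerDl; congr (_ + _).
by rewrite -[RHS]/((k%:A : A) *: (a *: (v : V))) scalerA -scalerAl mul1r.
Qed.

Lemma module_act_commutator a b v :
  module_act (a * b - b * a) v =
  module_act a (module_act b v) - module_act b (module_act a v).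
Proof. by rewrite /module_act scalerBl !scalerA. Qed.

Lemma module_act_exp a k v : (a ^+ k) *: (v : V) = iter k (module_act a) v.
Proof.
by elim: k => [|k IH]; rewrite ?expr0 ?scale1r // exprS -scalerA IH.
Qed.

End RestrictScalars.

Section CurrentAction.
Variables (K : fieldType) (L : lieAlgType K) (Q : lmodType (env (current L))).
Local Notation V := (restrict_scalars Q).

Definition current_act (x : current L) : {linear V -> V} :=
  @module_act K (env (current L)) Q (env_inj x).

Lemma current_action : lie_action current_act.
Proof.
split=> [v k x y|x y v]; rewrite /current_act /=.
  have -> : env_inj (k *: x + y) = k *: env_inj x + env_inj y by exact: linearP.
  exact: module_act_linearl.
by rewrite env_inj_lie module_act_commutator.
Qed.

End CurrentAction.

(** * Highest weight vectors for the current algebra *)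

Section HighestWeightVector.
Variables (K : numClosedFieldType) (L : finLieAlgType K) (H : {vspace L}).
Variables (n : nat) (D : n.-tuple (hstar H)).
Variables (hc : hstar H -> subvs_of H) (xp xm : hstar H -> L).
Hypotheses (simD : simple_roots D) (rvec : root_vectors D hc xp xm).
Hypothesis cartH : cartan_subalgebra H.
Variables (V : lmodType K) (r : current L -> {linear V -> V}) (w : V).
Variable la : hstar H.
Hypothesis actr : lie_action r.
Local Notation A := (tnth D).
Hypothesis w_raise : forall i p, r (xp (A i) \otimes p) w = 0.
Hypothesis w_cartan : forall i (s : nat), r (vsval (hc (A i)) \otimes 'X^s) w =
  (if s == 0%N then la (hc (A i)) : K else 0) *: w.
Hypothesis w_lower : forall i (m : nat), (la (hc (A i)) : K) = m%:R ->
  iter m.+1 (r (xm (A i) \otimes 1)) w = 0.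
Hypothesis la_dom : dominant_integral D hc la.

Lemma positive_raise a p : positive_root D a -> r (xp a \otimes p) w = 0.
Proof.
move=> posa; have [_ [c aE]] := posa; have [[_ _ ax _] _ _ _] := rvec posa.
move: p; apply: (positive_root_ind simD rvec cartH (s := false)
  (P := fun _ x => forall p, r (x \otimes p) w = 0) _ _ (c := c)).
- by move=> i k p; rewrite current_tensorZl (actionZ actr) w_raise scaler0.
- move=> _ i z zw p; rewrite -[p]mul1r -lie_current_tensor (action_lie actr).
  by rewrite zw w_raise !linear0 addr0.
- by rewrite /nat_comb -aE.
by rewrite scale1r /nat_comb -aE.
Qed.

Lemma positive_cartan a s : positive_root D a ->
  r (vsval (hc a) \otimes 'X^(s.+1)) w = 0.
Proof.
move=> posa; have [_ [c aE]] := posa.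
have := coroot_comb simD rvec (c := c); rewrite /nat_comb -aE => /(_ posa) ->.
rewrite linearZ linear_sum current_tensorZl (actionZ actr).
apply/eqP; rewrite scaler_eq0; apply/orP; right; apply/eqP.
have tensor_sum (I : Type) (t : seq I) (F : I -> L) q :
    (\sum_(i <- t) F i) \otimes q = \sum_(i <- t) (F i \otimes q).
  apply: (big_morph (fun x => x \otimes q)) => [x y|].
    exact: current_tensorDl.
  by rewrite -[in LHS](scale0r (0 : L)) current_tensorZl scale0r.
rewrite tensor_sum (action_sum actr) big1 // => i _.
by rewrite linearZ current_tensorZl (actionZ actr) w_cartan scale0r scaler0.
Qed.

Lemma tensor1_action : lie_action (fun x : L => r (x \otimes 1)).
Proof.
split=> [v k x y|x y v].
  by rewrite current_tensorDl current_tensorZl (actionD actr) (actionZ actr).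
by rewrite -(action_lie actr) lie_current_tensor mulr1.
Qed.

Lemma positive_lower a (N : nat) : positive_root D a ->
  (la (hc a) : K) = N%:R -> iter N.+1 (r (xm a \otimes 1)) w = 0.
Proof.
move=> posa laN.
apply: (lowering_power_eq0 simD rvec cartH tensor1_action _ _ _ posa laN) => i.
- exact: w_raise.
- by have := w_cartan i 0; rewrite expr0.
by have [m mE] := la_dom i; exists m => //; apply: w_lower.
Qed.

Lemma fusion_reduced_relations a xi : positive_root D a ->
  (sumn xi)%:R = la (hc a) :> K -> rectangular xi \/ special_fat_hook xi ->
  (forall s m k, (0 < s)%N -> (0 < m)%N -> (0 < k)%N ->
     (1 + m * k + sumn (drop k xi) <= s + m)%N ->
     iter s (r (xp a \otimes 'X)) (iter (s + m) (r (xm a \otimes 1)) w) = 0) <->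
  r (xm a \otimes 'X^(size xi)) w = 0 /\
  (special_fat_hook xi -> iter (nth 0%N xi (size xi).-1).+1
     (r (xm a \otimes 'X^((size xi).-1))) w = 0).
Proof.
move=> posa xiE shape; have weyl := positive_lower posa (esym xiE).
have [[_ _ _ ay] hx hy xy] := rvec posa.
pose f p := r (xm a \otimes 'X^p); pose h p := r (vsval (hc a) \otimes 'X^p).
pose e := r (xp a \otimes 'X).
have fC p q v : f p (f q v) = f q (f p v).
  rewrite /f (actionC actr) lie_current_tensor liexx.
  have -> : (0 : L) \otimes ('X^p * 'X^q) = 0.
    by rewrite -[in LHS](scale0r (0 : L)) current_tensorZl scale0r.
  by rewrite (action0 actr) addr0.
have ef p v : e (f p v) = f p (e v) + h p.+1 v.
  by rewrite /e /f (actionC actr) lie_current_tensor xy -exprS.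
have hf p q v : h p (f q v) = f q (h p v) - 2 *: f (p + q)%N v.
  rewrite /h /f (actionC actr) lie_current_tensor hy -exprD.
  by rewrite -[in LHS]scaleNr current_tensorZl (actionZ actr) scaleNr.
have ew : e w = 0 by apply: positive_raise.
have hw p : h p.+1 w = 0 by apply: positive_cartan.
have f0 : r (xm a \otimes 1) = f 0%N by rewrite /f expr0.
rewrite f0 in weyl *.
have fusE : (forall s m k, (0 < s)%N -> (0 < m)%N -> (0 < k)%N ->
     (1 + m * k + sumn (drop k xi) <= s + m)%N ->
     iter s e (iter (s + m) (f 0%N) w) = 0) <-> fusion_vanishing f w xi.
  have gar := garland fC ef hf ew hw.
  split=> van s m k s0 m0 k0 ge; have [c c0 cE] := gar m s.
    apply/eqP; rewrite -[_ == 0]orFb -(negPf c0) -scaler_eq0 -cE.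
    by rewrite (van _ _ k).
  by rewrite cE (van _ _ k) // scaler0.
split=> [/fusE fus|red].
  exact: (fusion_reduced_vanishing fC hf hw weyl fus).
apply/fusE; exact: (reduced_fusion_vanishing fC ef hf ew hw shape weyl red).
Qed.

End HighestWeightVector.

(** * The two presentations *)

Section QuotientIsomorphism.
Variables (R : pzRingType) (V : lmodType R).
Implicit Types S T : V -> Prop.

Lemma quot_proj_eq0 S v : quot_proj S v = 0 <-> v \in gen_submod S.
Proof. by rewrite -[0](linear0 (quot_proj S)) quot_projP subr0. Qed.

Lemma gen_submod_subset S T : (forall v, S v -> quot_proj T v = 0) ->
  {subset gen_submod S <= gen_submod T}.
Proof.
move=> ST; apply: gen_submod_min; first exact: gen_submod_closed.
by move=> v /ST/quot_proj_eq0.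
Qed.

(** Both sets generate the same submodule, so choosing representatives gives well-defined, mutually
    inverse maps. *)
Lemma quot_submod_isomorphic S T : (forall v, S v -> quot_proj T v = 0) ->
  (forall v, T v -> quot_proj S v = 0) ->
  isomorphic (quot_submod S) (quot_submod T).
Proof.
move=> /gen_submod_subset ST /gen_submod_subset TS.
pose f (q : quot_submod S) : quot_submod T := quot_proj T (repr q).
pose g (q : quot_submod T) : quot_submod S := quot_proj S (repr q).
have fE v : f (quot_proj S v) = quot_proj T v.
  by apply/quot_projP/ST/quot_projP; rewrite quot_proj_repr.
have gE v : g (quot_proj T v) = quot_proj S v.
  by apply/quot_projP/TS/quot_projP; rewrite quot_proj_repr.
have flin : linear f.
  move=> a p q; rewrite -[p]quot_proj_repr -[q]quot_proj_repr.
  by rewrite -linearP !fE linearP.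
pose F : {linear quot_submod S -> quot_submod T} :=
  HB.pack f (GRing.isLinear.Build R _ _ _ f flin).
exists F; exists g => q; first by rewrite /= -[q]quot_proj_repr fE gE.
by rewrite /= -[q]quot_proj_repr gE fE.
Qed.

End QuotientIsomorphism.

Section Presentations.
Variables (K : numClosedFieldType) (L : finLieAlgType K) (H : {vspace L}).
Variables (n : nat) (D : n.-tuple (hstar H)).
Variables (hc : hstar H -> subvs_of H) (xp xm : hstar H -> L).
Variables (la : hstar H) (xi : hstar H -> seq nat).
Hypotheses (simD : simple_roots D) (rvec : root_vectors D hc xp xm).
Hypothesis cartH : cartan_subalgebra H.
Hypothesis la_dom : dominant_integral D hc la.
Hypothesis xi_compat : compatible D hc la xi.
Hypothesis xi_shape : forall a, positive_root D a ->
  rectangular (xi a) \/ special_fat_hook (xi a).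

Local Notation Ut := (env (current L)).
Local Notation W := (local_weyl D hc xp xm la).
Local Notation w := (local_weyl_gen D hc xp xm la).

Lemma local_weyl_gen_rel u : local_weyl_rel D hc xp xm la u -> u *: w = 0.
Proof.
move=> relu; rewrite /local_weyl_gen -linearZ; apply/quot_proj_eq0.
rewrite -[u *: 1]/(u * 1) mulr1; exact: gen_submod_sub.
Qed.

(** The target is arbitrary so that [phi] can be the projection onto either quotient; [phi w]
    inherits the local Weyl relations. *)
Lemma presentation_relations (Q : lmodType Ut) (phi : {linear W -> Q}) :
  (forall v, V_rel xi v -> phi v = 0) <->
  (forall v, reduced_rel xi v -> phi v = 0).
Proof.
pose q : restrict_scalars Q := phi w.
have relq u : local_weyl_rel D hc xp xm la u -> module_act u q = 0.
  by move=> /local_weyl_gen_rel uw; rewrite /module_act -linearZ uw linear0.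
have raise i p : current_act Q (xp (tnth D i) \otimes p) q = 0.
  exact/relq/LWraise.
have cartan i (s : nat) : current_act Q (vsval (hc (tnth D i)) \otimes 'X^s) q =
    (if s == 0%N then la (hc (tnth D i)) : K else 0) *: q.
  have := relq _ (LWcartan D hc xp xm la i s); rewrite /module_act scalerBl.
  by move/eqP; rewrite subr_eq0 => /eqP.
have lower i (m : nat) : (la (hc (tnth D i)) : K) = m%:R ->
    iter m.+1 (current_act Q (xm (tnth D i) \otimes 1)) q = 0.
  by move=> /LWlower/relq; rewrite /module_act module_act_exp.
have rel a (posa : positive_root D a) := fusion_reduced_relations simD rvec cartH
  (current_action Q) raise cartan lower la_dom posa (xi_compat posa).2 (xi_shape posa).
have iterE (x y : current L) (s m : nat) :
    phi ((env_inj x ^+ s * env_inj y ^+ m) *: w) =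
    iter s (current_act Q x) (iter m (current_act Q y) q).
  by rewrite linearZ /= -scalerA !module_act_exp.
have iterE1 (y : current L) (m : nat) :
    phi ((env_inj y ^+ m) *: w) = iter m (current_act Q y) q.
  by rewrite linearZ /= module_act_exp.
split=> van v.
  have fus a (posa : positive_root D a) := proj1 (rel a posa)
    (fun s m k s0 m0 k0 ge => etrans (esym (iterE _ _ s (s + m)%N))
       (van _ (VRel hc xp xm la posa s0 m0 k0 ge))).
  case=> [a posa|a posa hook]; last by rewrite iterE1; apply: (fus a posa).2.
  by rewrite -[X in X *: _]expr1 iterE1; apply: (fus a posa).1.
case=> a s m k posa s0 m0 k0 ge; rewrite iterE.
have [_ red] := rel a posa; apply: (red _ s m k) => //; split=> [|hook].
  by have := van _ (RedTop _ _ _ _ _ posa); rewrite -[X in X *: _]expr1 iterE1.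
by have := van _ (RedHook _ _ _ _ posa hook); rewrite iterE1.
Qed.

Lemma V_module_reduced :
  isomorphic (V_module D hc xp xm la xi) (reduced_module D hc xp xm la xi).
Proof.
apply: quot_submod_isomorphic => v.
  apply: (proj2 (presentation_relations (quot_proj _))) => u red.
  by apply/quot_proj_eq0/gen_submod_sub.
apply: (proj1 (presentation_relations (quot_proj _))) => u fus.
by apply/quot_proj_eq0/gen_submod_sub.
Qed.


End Presentations.

Theorem theorem1 (R : realType) (L : finLieAlgType R[i]) (H : {vspace L})
    (n : nat) (D : n.-tuple (hstar H))
    (hc : hstar H -> subvs_of H) (xp xm : hstar H -> L)
    (la : hstar H) (xi : hstar H -> seq nat) :
  simple_lie L -> cartan_subalgebra H -> simple_roots D ->
  root_vectors D hc xp xm ->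
  dominant_integral D hc la -> la != 0 ->
  compatible D hc la xi ->
  (forall a, positive_root D a -> rectangular (xi a) \/ special_fat_hook (xi a)) ->
  isomorphic (V_module D hc xp xm la xi) (reduced_module D hc xp xm la xi).
Proof.
by move=> _ cartH simD rvec la_dom _ xi_compat xi_shape; apply: V_module_reduced.
Qed.
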